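(* Let $[\mathfrak A,n,0,\beta]$ be a maximal simple stratum in $A=\mathrm{End}_F(V)$ with $F[\beta]/F$ tamely ramified, and let $[\mathfrak A,n,r_i,\beta_i]$, $0\le i\le s$, be a defining sequence of it with $\beta_0=\beta$ such that, for $0\le i\le s-1$, $F[\beta_{i+1}]\subsetneq F[\beta_i]$ and $[\mathfrak B_{\beta_{i+1}},r_{i+1},r_{i+1}-1,\beta_i-\beta_{i+1}]$ is a simple stratum in $\mathrm{End}_{F[\beta_{i+1}]}(V)$. Assume $\beta_s\notin F$. Put $c_i=\beta_i-\beta_{i+1}$ for $0\le i\le s-1$ and $c_s=\beta_s$. Then $$H^1(\beta,\mathfrak A)=U^1(\mathfrak B_{\beta_0})\,U^{[\frac{-\nu_{\mathfrak A}(c_0)}{2}]+1}(\mathfrak B_{\beta_1})\cdots U^{[\frac{-\nu_{\mathfrak A}(c_{s-1})}{2}]+1}(\mathfrak B_{\beta_s})\,U^{[\frac{-\nu_{\mathfrak A}(c_s)}{2}]+1}(\mathfrak A).$$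
   Context: $F$ is a non-Archimedean local field with ring of integers $\mathfrak o_F$; $V$ is a finite-dimensional $F$-vector space and $A=\mathrm{End}_F(V)$; $[x]$ is the integer part. A hereditary $\mathfrak o_F$-order in $A$ is $\mathfrak A=\{x\in A: xL_i\subset L_i\ \forall i\}$ for an $\mathfrak o_F$-lattice chain $\{L_i\}_{i\in\mathbb Z}$ in $V$; $\mathfrak P$ is its Jacobson radical, $\nu_{\mathfrak A}(x)=\max\{k\in\mathbb Z: x\in\mathfrak P^k\}$, $\mathfrak K(\mathfrak A)$ its normaliser in $A^\times$, $U^0(\mathfrak A)=\mathfrak A^\times$ and $U^k(\mathfrak A)=1+\mathfrak P^k$ for $k\ge1$ (same notation for hereditary orders in $\mathrm{End}_K(V)$, $K/F$ finite). A stratum in $A$ is $[\mathfrak A,n,r,\beta]$ with $\mathfrak A$ a hereditary $\mathfrak o_F$-order, $n>r$ integers, $\beta\in A$ and $\nu_{\mathfrak A}(\beta)\ge -n$. It is pure if $E=F[\beta]$ is a field, $E^\times\subset\mathfrak K(\mathfrak A)$ and $\nu_{\mathfrak A}(\beta)=-n$. For a pure stratum put $\mathfrak N_k(\beta,\mathfrak A)=\{x\in\mathfrak A:\beta x-x\beta\in\mathfrak P^k\}$, $\mathfrak B_\beta=\mathfrak A\cap\mathrm{End}_{F[\beta]}(V)$, and $k_0(\beta,\mathfrak A)=-\infty$ if $E=F$, $k_0(\beta,\mathfrak A)=\max\{k:\mathfrak N_k(\beta,\mathfrak A)\not\subset\mathfrak B_\beta+\mathfrak P\}$ if $E\ne F$.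 A stratum is simple if it is pure and $r<-k_0(\beta,\mathfrak A)$. A simple stratum is maximal if $\mathfrak B_\beta$ is a maximal $\mathfrak o_E$-order in $\mathrm{End}_E(V)$. Strata $[\mathfrak A,n,r,\beta_1]$, $[\mathfrak A,n,r,\beta_2]$ are equivalent ($\sim$) if $\beta_1-\beta_2\in\mathfrak P^{-r}$. For a finite extension $K/F$ inside $A$ the same notions are used in $\mathrm{End}_K(V)$ with $F$ replaced by $K$. A tame corestriction on $A$ relative to $K/F$ (with $B=\mathrm{End}_K(V)$) is a $(B,B)$-bimodule homomorphism $s:A\to B$ with $s(\mathfrak A)=\mathfrak A\cap B$ for every hereditary $\mathfrak o_F$-order $\mathfrak A$ normalised by $K^\times$. A defining sequence of $[\mathfrak A,n,r,\beta]$ is a family $[\mathfrak A,n,r_i,\beta_i]$, $0\le i\le s$, such that: (i) each is simple; (ii) $[\mathfrak A,n,r_0,\beta_0]\sim[\mathfrak A,n,r,\beta]$; (iii) $r=r_0<\dots<r_s<n$ and $[F[\beta_0]:F]>\dots>[F[\beta_s]:F]$; (iv) for $0\le i\le s-1$, $r_{i+1}=-k_0(\beta_i,\mathfrak A)$ and $[\mathfrak A,n,r_{i+1},\beta_{i+1}]\sim[\mathfrak A,n,r_{i+1},\beta_i]$; (v) $k_0(\beta_s,\mathfrak A)\in\{-n,-\infty\}$; (vi) for $0\le i\le s-1$, $[\mathfrak B_{\beta_{i+1}},r_{i+1},r_{i+1}-1,s_{i+1}(\beta_i-\beta_{i+1})]$ is equivalent to a simple stratum, $s_{i+1}$ a tame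 corestriction relative to $F[\beta_{i+1}]/F$. Definition of $H^1$: $\mathfrak H(\beta_s,\mathfrak A)=\mathfrak B_{\beta_s}+\mathfrak P^{[n/2]+1}$, and for $0\le i<s$, $\mathfrak H(\beta_i,\mathfrak A)=\mathfrak B_{\beta_i}+\mathfrak H(\beta_{i+1},\mathfrak A)\cap\mathfrak P^{[r_{i+1}/2]+1}$ (recall $r_{i+1}=-k_0(\beta_i,\mathfrak A)$). Then $H^m(\beta,\mathfrak A)=\mathfrak H(\beta,\mathfrak A)\cap U^m(\mathfrak A)$ for $m\ge 0$. These do not depend on the choice of the defining sequence. *)

(* Defs.v *)
From HB Require Import structures.
From mathcomp Require Import all_boot all_order all_algebra.
From mathcomp Require Import boolp classical_sets constructive_ereal.

Set Implicit Arguments.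
Unset Strict Implicit.
Unset Printing Implicit Defensive.

Import Order.TTheory GRing.Theory Num.Theory.

Local Open Scope classical_set_scope.
Local Open Scope ring_scope.

(* Supremum of a set of integers in \bar int: the maximum when there is one,
   -oo for the empty set, +oo for a nonempty set that is not bounded above. *)
Definition zsup (S : set int) : \bar int :=
  supremum (-oo)%E [set k%:E%E | k in S].

(* v is the normalised discrete valuation of F. *)
Record nonarch_local_field (F : fieldType) (v : F -> \bar int) : Prop :=
  NonarchLocalField {
    lf_val0 : forall x, v x = +oo%E <-> x = 0;
    lf_valM : forall x y, v (x * y) = (v x + v y)%E;
    lf_valD : forall x y, (Order.min (v x) (v y) <= v (x + y)%R)%E;
    lf_uniformizer : exists pi, v pi = 1%:E%E;
    lf_complete : forall u : nat -> F,
      (forall k : int, exists N : nat, forall i j : nat,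
         (N <= i)%N -> (N <= j)%N -> (k%:E <= v (u i - u j)%R)%E) ->
      exists l : F, forall k : int, exists N : nat, forall i : nat,
         (N <= i)%N -> (k%:E <= v (u i - l)%R)%E;
    lf_residue_finite : exists t : seq F, forall x, (0 <= v x)%E ->
      exists2 y, y \in t & (0 < v (x - y)%R)%E }.

(* The additive subgroup generated by the act x y, x in X, y in Y. *)
Definition mulspan (T : Type) (W1 W2 : zmodType) (act : T -> W1 -> W2)
    (X : set T) (Y : set W1) : set W2 :=
  [set z | exists m (x : 'I_m -> T) (y : 'I_m -> W1),
    [/\ forall i, X (x i), forall i, Y (y i) & z = \sum_i act (x i) (y i)]].

Section Endomorphisms.
Context (F : fieldType) (v : F -> \bar int) (V : vectType F).
Local Notation A := 'End(V).
Local Notation comp := (fun x y : A => (x \o y)%VF).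
Local Notation ev := (fun (x : A) (w : V) => x w).

Definition epow (x : A) (i : nat) : A := iter i (fun y : A => (x \o y)%VF) \1%VF.

Definition setcomp (X Y : set A) : set A := [set (x \o y)%VF | x in X & y in Y].

Definition setadd (X Y : set A) : set A := [set x + y | x in X & y in Y].

(* Fields between F and A are subsets of A. The base field is scalars, and all
   the notions for End_K(V) below take the subset K as a parameter, so that the
   case of End_F(V) is K := scalars. *)
Definition scalars : set A := [set a *: \1%VF | a in [set: F]].

Definition is_field (K : set A) : Prop :=
  [/\ K \1%VF, \1%VF <> 0 :> A,
      forall x y, K x -> K y -> K (x - y) /\ K (x \o y)%VF,
      forall x y, K x -> K y -> (x \o y)%VF = (y \o x)%VF &
      forall x, K x -> x <> 0 -> exists2 y, K y & (x \o y)%VF = \1%VF].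

Definition adjoin (K : set A) (b : A) : set A :=
  mulspan comp K (range (epow b)).

(* [E : F] for an F-linear subspace E of A. *)
Definition degF (E : set A) : nat :=
  xget 0%N [set d | exists2 U : {vspace A}, E = [set` U] & d = \dim U].

Definition End_over (K : set A) : set A :=
  [set x | forall k, K k -> (x \o k)%VF = (k \o x)%VF].

Definition integral_over (x : A) : Prop :=
  exists p : {poly F}, [/\ p \is monic, forall i, (0 <= v p`_i)%E &
    \sum_(i < size p) p`_i *: epow x i = 0].

Definition int_ring (K : set A) : set A := K `&` integral_over.

Definition units (R : set A) : set A :=
  R `&` [set x | exists2 y, R y & (x \o y)%VF = \1%VF /\ (y \o x)%VF = \1%VF].

Definition max_ideal (K : set A) : set A := int_ring K `\` units (int_ring K).

(* I^m inside the ring R, with I^0 = R. *)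
Fixpoint ideal_exp (R I : set A) (m : nat) : set A :=
  if m is m'.+1 then mulspan comp (ideal_exp R I m') I else R.

Definition ramification_index (E : set A) (e : nat) : Prop :=
  mulspan comp (max_ideal scalars) (int_ring E)
    = ideal_exp (int_ring E) (max_ideal E) e.

(* Residue fields are finite, hence residue extensions are separable and
   tameness only concerns the ramification index. *)
Definition tamely_ramified (E : set A) : Prop :=
  exists2 e, ramification_index E e &
    forall p : nat, prime p -> (0 < v (p%:R)%R)%E -> ~~ (p %| e)%N.

(* L is a finitely generated module over the integers of K that spans the
   K-space W0. *)
Definition is_lattice (K : set A) (W : zmodType) (act : A -> W -> W)
    (W0 L : set W) : Prop :=
  (exists t : seq W, L = mulspan act (int_ring K) [set` t])
  /\ mulspan act K L = W0.

Definition lattice_chain (K : set A) (L : int -> set V) : Prop :=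
  [/\ forall i, is_lattice K ev [set: V] (L i),
      forall i : int, L (i + 1) `<` L i &
      exists2 e : nat, (0 < e)%N &
        forall i : int, mulspan ev (max_ideal K) (L i) = L (i + e%:Z)].

Definition hereditary_order (K R : set A) : Prop :=
  exists2 L : int -> set V, lattice_chain K L &
    R = End_over K `&` [set x | forall i, ev x @` L i `<=` L i].

Definition is_order (K R : set A) : Prop :=
  [/\ is_lattice K comp (End_over K) R, R \1%VF &
      forall x y, R x -> R y -> R (x \o y)%VF].

Definition maximal_order (K R : set A) : Prop :=
  is_order K R /\ forall R', is_order K R' -> R `<=` R' -> R' = R.

Definition left_ideal (R I : set A) : Prop :=
  [/\ I `<=` R, I 0, forall x y, I x -> I y -> I (x - y) &
      forall a x, R a -> I x -> I (a \o x)%VF].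

Definition maximal_left_ideal (R I : set A) : Prop :=
  [/\ left_ideal R I, I <> R &
      forall J, left_ideal R J -> I `<=` J -> J = I \/ J = R].

Definition jacobson_radical (R : set A) : set A :=
  R `&` [set x | forall I, maximal_left_ideal R I -> I x].

(* P^k for k : int, P the radical of R. For k < 0 this is the inverse of the
   invertible ideal P^(-k), namely the x in End_K(V) with x P^(-k) in R. *)
Definition rad_exp (K R : set A) (k : int) : set A :=
  match k with
  | Posz m => ideal_exp R (jacobson_radical R) m
  | Negz m => End_over K `&`
      [set x | forall y, ideal_exp R (jacobson_radical R) m.+1 y -> R (x \o y)%VF]
  end.

Definition nu (K R : set A) (x : A) : \bar int :=
  zsup [set k | rad_exp K R k x].

Definition normaliser (K R : set A) : set A :=
  [set g | exists h, [/\ End_over K g, End_over K h,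
     (g \o h)%VF = \1%VF, (h \o g)%VF = \1%VF &
     [set (g \o x \o h)%VF | x in R] = R]].

(* Only k >= 0 is meaningful. *)
Definition U (K R : set A) (k : int) : set A :=
  if 0 < k then [set \1%VF + x | x in rad_exp K R k] else units R.

Definition stratum (K R : set A) (n r : int) (b : A) : Prop :=
  [/\ hereditary_order K R, r < n, End_over K b & ((- n)%:E <= nu K R b)%E].

Definition pure_stratum (K R : set A) (n r : int) (b : A) : Prop :=
  [/\ stratum K R n r b, is_field (adjoin K b),
      adjoin K b `\ 0 `<=` normaliser K R & nu K R b = (- n)%:E%E].

Definition frakN (K R : set A) (b : A) (k : int) : set A :=
  R `&` [set x | rad_exp K R k ((b \o x)%VF - (x \o b)%VF)].

Definition frakB (K R : set A) (b : A) : set A := R `&` End_over (adjoin K b).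

Definition k0 (K R : set A) (b : A) : \bar int :=
  if `[< adjoin K b = K >] then -oo%E
  else zsup [set k | ~ (frakN K R b k
                          `<=` setadd (frakB K R b) (jacobson_radical R))].

Definition simple_stratum (K R : set A) (n r : int) (b : A) : Prop :=
  pure_stratum K R n r b /\ (r%:E < - k0 K R b)%E.

Definition maximal_simple_stratum (K R : set A) (n r : int) (b : A) : Prop :=
  simple_stratum K R n r b /\ maximal_order (adjoin K b) (frakB K R b).

Definition equiv_strata (K R : set A) (n r : int) (b1 b2 : A) : Prop :=
  [/\ stratum K R n r b1, stratum K R n r b2 & rad_exp K R (- r) (b1 - b2)].

Definition tame_corestriction (K : set A) (s : A -> A) : Prop :=
  [/\ forall x, End_over K (s x),
      forall x y, s (x + y) = s x + s y,
      forall b x b', End_over K b -> End_over K b' ->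
        s (b \o x \o b')%VF = (b \o s x \o b')%VF &
      forall R, hereditary_order scalars R ->
        K `\ 0 `<=` normaliser scalars R -> s @` R = R `&` End_over K].

(* Only the values of b and r at i <= s matter. *)
Record defining_sequence (R : set A) (n r0 : int) (beta : A)
    (s : nat) (b : nat -> A) (r : nat -> int) : Prop := DefiningSequence {
  ds_simple : forall i, (i <= s)%N -> simple_stratum scalars R n (r i) (b i);
  ds_first : equiv_strata scalars R n (r 0%N) (b 0%N) beta;
  ds_r0 : r 0%N = r0;
  ds_r_incr : forall i, (i < s)%N -> r i < r i.+1;
  ds_r_last : r s < n;
  ds_deg_decr : forall i, (i < s)%N ->
    (degF (adjoin scalars (b i.+1)) < degF (adjoin scalars (b i)))%N;
  ds_r_k0 : forall i, (i < s)%N -> ((r i.+1)%:E = - k0 scalars R (b i))%E;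
  ds_next : forall i, (i < s)%N ->
    equiv_strata scalars R n (r i.+1) (b i.+1) (b i);
  ds_last : k0 scalars R (b s) = (- n)%:E%E \/ k0 scalars R (b s) = -oo%E;
  ds_derived : forall i, (i < s)%N ->
    let K := adjoin scalars (b i.+1) in
    let B := frakB scalars R (b i.+1) in
    exists2 cor, tame_corestriction K cor &
    exists2 g, simple_stratum K B (r i.+1) (r i.+1 - 1) g &
      equiv_strata K B (r i.+1) (r i.+1 - 1) (cor (b i - b i.+1)) g }.

(* The order H(b 0) attached to the sequence b 0, ..., b s; H(b 1) is the order
   attached to the shifted sequence b 1, ..., b s. *)
Fixpoint frakH (R : set A) (n : int) (s : nat) (b : nat -> A) (r : nat -> int)
    : set A :=
  match s with
  | 0%N => setadd (frakB scalars R (b 0%N)) (rad_exp scalars R ((n %/ 2)%Z + 1))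
  | s'.+1 =>
      setadd (frakB scalars R (b 0%N))
        (frakH R n s' (fun i => b i.+1) (fun i => r i.+1)
         `&` rad_exp scalars R ((r 1%N %/ 2)%Z + 1))
  end.

Definition Hgroup (R : set A) (n : int) (s : nat) (b : nat -> A) (r : nat -> int)
    (m : int) : set A :=
  frakH R n s b r `&` U scalars R m.

Definition diff_seq (s : nat) (b : nat -> A) (i : nat) : A :=
  if (i < s)%N then b i - b i.+1 else b s.

(* [- nu(c) / 2] + 1 for nonzero c; %/ on int rounds down. *)
Definition half_level (R : set A) (c : A) : int :=
  ((- fine (nu scalars R c)) %/ 2)%Z + 1.

End Endomorphisms.

(* Main.v *)
(** The lattice chain L of the order A filters V, and A is the set of degree 0
    maps of this filtration. Elements of the normaliser of A permute the lattices
    of L, so for every E with E^* in that normaliser L is also an o_E-chain, and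
    B = A \cap End_E(V) is the set of E-linear maps of degree 0. Given w in L_j
    outside L_(j+1), a K-linear form equal to 1 at w and as integral as this
    allows provides enough K-linear operators of rank one to identify rad(B) with
    the E-linear maps of degree 1, and rad(B)^k with those of degree k, for all
    integers k: rad(B)^k = P^k \cap End_E(V). Hence nu_A(c_i) = -r_(i+1), and by the
    modular law the part of H(beta) in P is the sum of the B_i \cap P^([r_i/2]+1)
    (with r_0 = 0) and of P^([n/2]+1). As B_0 is contained in B_1, B_1 in B_2, and so
    on, each summand is stable under left multiplication by the previous orders, and
    1 + y + x = (1 + y)(1 + (1 + y)^-1 x) turns the sum into a product. *)

Require Import Defs.
From HB Require Import structures.
From mathcomp Require Import all_boot all_order all_algebra.
From mathcomp Require Import boolp classical_sets constructive_ereal.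
From mathcomp Require Import zify.

Set Implicit Arguments.
Unset Strict Implicit.
Unset Printing Implicit Defensive.

Import Order.TTheory GRing.Theory Num.Theory.

Local Open Scope classical_set_scope.
Local Open Scope ring_scope.

(** * Additive subgroups generated by products *)

Lemma mulspan0 (T : Type) (W1 W2 : zmodType) (act : T -> W1 -> W2)
    (X : set T) (Y : set W1) : mulspan act X Y 0.
Proof.
(* [T] may be empty, so the empty families are built from absurdity. *)
exists 0%N, (fun k : 'I_0 => False_rect T (notF (ltn_ord k))),
  (fun k : 'I_0 => False_rect W1 (notF (ltn_ord k))).
by split; [case|case|rewrite big_ord0].
Qed.

Lemma mulspan_sum (T I : Type) (W1 W2 : zmodType) (act : T -> W1 -> W2)
    (X : set T) (Y : set W1) (t : seq I) (x : I -> T) (y : I -> W1) :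
  (forall i, X (x i)) -> (forall i, Y (y i)) ->
  mulspan act X Y (\sum_(i <- t) act (x i) (y i)).
Proof.
case: t => [|i0 t] Xx Yy.
  by rewrite big_nil; apply: mulspan0.
exists (size (i0 :: t)), (fun k => x (nth i0 (i0 :: t) k)),
  (fun k => y (nth i0 (i0 :: t) k)); split=> //.
by rewrite (big_nth i0) big_mkord.
Qed.

Lemma mulspan_min (T : Type) (W1 W2 : zmodType) (act : T -> W1 -> W2)
    (X : set T) (Y : set W1) (S : set W2) :
  S 0 -> (forall z z', S z -> S z' -> S (z + z')) ->
  (forall x y, X x -> Y y -> S (act x y)) -> mulspan act X Y `<=` S.
Proof.
by move=> S0 SD SXY _ [m [x [y [Xx Yy ->]]]]; apply: big_ind => // i _; apply: SXY.
Qed.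

Lemma mulspan_mul (T : Type) (W1 W2 : zmodType) (act : T -> W1 -> W2)
    (X : set T) (Y : set W1) x y : X x -> Y y -> mulspan act X Y (act x y).
Proof.
move=> Xx Yy; have := @mulspan_sum T unit _ _ act X Y [:: tt] (fun=> x) (fun=> y).
by rewrite big_seq1; apply.
Qed.

Lemma mulspanD (T : Type) (W1 W2 : zmodType) (act : T -> W1 -> W2)
    (X : set T) (Y : set W1) z z' :
  mulspan act X Y z -> mulspan act X Y z' -> mulspan act X Y (z + z').
Proof.
move=> [m [x [y [Xx Yy ->]]]] [m' [x' [y' [Xx' Yy' ->]]]].
pose f (B : Type) (g : 'I_m -> B) (g' : 'I_m' -> B) (i : 'I_m + 'I_m') :=
  match i with inl i => g i | inr i => g' i end.
have := @mulspan_sum T ('I_m + 'I_m')%type _ _ act X Y (index_enum _) (f T x x') (f W1 y y').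
by rewrite big_sumType; apply; case.
Qed.

(** * Subspaces, centralisers and subfields of [End(V)] *)

Section LatticeChains.
Context (F : fieldType) (V : vectType F).
Local Notation A := 'End(V).
Local Notation comp := (fun x y : A => (x \o y)%VF).

Lemma lfun_of_linear (f : V -> V) :
  (forall a u w, f (a *: u + w) = a *: f u + f w) ->
  exists y : A, forall u, y u = f u.
Proof.
move=> f_lin; pose fL : {linear V -> V} :=
  HB.pack f (GRing.isLinear.Build F V V *:%R f f_lin).
by exists (linfun fL) => u; rewrite lfunE.
Qed.

(** Dimensions are bounded by that of V, so a largest one is attained. *)
Lemma maximal_vspace (P : {vspace V} -> Prop) U0 : P U0 ->
  exists2 U, P U & forall U', P U' -> (\dim U' <= \dim U)%N.
Proof.
move=> PU0; pose p d := `[< exists2 U, P U & \dim U = d >].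
have p_ex : exists d, p d by exists (\dim U0); apply/asboolP; exists U0.
have p_le d : p d -> (d <= \dim {:V})%N.
  by case/asboolP=> U _ <-; apply: dimvS; apply: subvf.
case: (ex_maxnP p_ex p_le) => d /asboolP[U PU <-] d_max.
by exists U => // U' PU'; apply: d_max; apply/asboolP; exists U'.
Qed.

(** A subspace of largest dimension inside [X] already contains every [u] in [X], since adding the
    line of [u] to it stays inside [X]. *)
Lemma vspace_of_subset (X : set V) : X 0 ->
  (forall a u w, X u -> X w -> X (a *: u + w)) ->
  exists U : {vspace V}, forall u, (u \in U) <-> X u.
Proof.
move=> X0 X_lin; pose P (U : {vspace V}) := forall u, u \in U -> X u.
have P0 : P 0%VS by move=> u; rewrite memv0 => /eqP->.
have [U PU U_max] := maximal_vspace P0.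
exists U => u; split=> [/PU//|Xu].
have /U_max dim_le : P (<[u]> + U)%VS.
  by move=> _ /memv_addP[_ /vlineP[a ->] [w /PU Xw ->]]; apply: X_lin.
have /eqP -> : U == (<[u]> + U)%VS.
  by rewrite eqEdim addvSr.
by apply: subvP (addvSl _ _) _ (memv_line u).
Qed.

Lemma End_over_scalars : End_over (@scalars F V) = [set: A].
Proof.
apply/seteqP; split=> // x _ _ [a _ <-].
by apply/lfunP => u; rewrite !lfun_simp linearZ.
Qed.

Lemma End_over_comp (K : set A) x y :
  End_over K x -> End_over K y -> End_over K (x \o y)%VF.
Proof. by move=> Kx Ky k Kk; rewrite -comp_lfunA Ky// comp_lfunA Kx// comp_lfunA. Qed.

Lemma End_over_id (K : set A) : End_over K \1%VF.
Proof. by move=> k _; rewrite comp_lfun1l comp_lfun1r. Qed.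

Lemma End_over_lin (K : set A) x y a :
  End_over K x -> End_over K y -> End_over K (a *: x + y).
Proof.
move=> Kx Ky k Kk.
by rewrite comp_lfunDl comp_lfunDr -comp_lfunZl -comp_lfunZr Kx// Ky.
Qed.

Lemma End_over0 (K : set A) : End_over K 0.
Proof. by move=> k _; rewrite comp_lfun0l comp_lfun0r. Qed.

Lemma End_overB (K : set A) x y :
  End_over K x -> End_over K y -> End_over K (x - y).
Proof. by move=> Kx Ky; rewrite -scaleN1r addrC; apply: End_over_lin. Qed.

Lemma End_overD (K : set A) x y :
  End_over K x -> End_over K y -> End_over K (x + y).
Proof. by move=> Kx Ky; rewrite -[x]scale1r; apply: End_over_lin. Qed.

Lemma End_overE (K : set A) x k u : End_over K x -> K k -> x (k u) = k (x u).
Proof. by move=> Kx Kk; rewrite -!comp_lfunE Kx. Qed.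

Lemma End_over_inv (K : set A) x y : End_over K x ->
  (x \o y)%VF = \1%VF -> (y \o x)%VF = \1%VF -> End_over K y.
Proof.
move=> Kx xy yx k Kk.
rewrite -[LHS]comp_lfun1r -xy comp_lfunA -[(y \o k \o x)%VF]comp_lfunA -Kx//.
by rewrite comp_lfunA yx comp_lfun1l.
Qed.

Lemma is_field_ops (K : set A) : is_field K ->
  [/\ K 0, K \1%VF, (forall x y, K x -> K y -> K (x + y)),
      (forall x y, K x -> K y -> K (x - y)) &
      (forall x y, K x -> K y -> K (x \o y)%VF)].
Proof.
case=> K1 _ Ksub _ _.
have K0 : K 0 by rewrite -(subrr \1%VF); apply: (Ksub _ _ K1 K1).1.
split=> // x y Kx Ky; first last.
- exact: (Ksub _ _ Kx Ky).2.
- exact: (Ksub _ _ Kx Ky).1.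
- rewrite -[y]opprK -[- y]add0r.
  by apply: (Ksub _ _ Kx _).1; apply: (Ksub _ _ K0 Ky).1.
Qed.

Lemma is_field_inv (K : set A) x : is_field K -> K x -> x <> 0 ->
  exists y, [/\ K y, (x \o y)%VF = \1%VF & (y \o x)%VF = \1%VF].
Proof.
case=> _ _ _ KC Kinv Kx x0; have [y Ky xy] := Kinv x Kx x0.
by exists y; split=> //; rewrite -(KC x y).
Qed.

(** * Filtrations of V and the degree of a map *)

Lemma chain_antitone (L : int -> set V) : (forall i, L (i + 1) `<` L i) ->
  forall i j, i <= j -> L j `<=` L i.
Proof.
move=> L_lt i j le_ij; have -> : j = i + `|j - i|%N%:Z by lia.
elim: `|j - i|%N => [|m IHm]; first by rewrite addr0.
apply: subset_trans IHm; have -> : i + m.+1%:Z = i + m%:Z + 1 by lia.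
exact: (L_lt _).1.
Qed.

(** What the argument takes from a lattice chain, with no mention of the valuation. [fl_closed] says
    that every subspace is closed in the topology that has the [L i] as neighbourhoods of 0; for the
    zero subspace this is separatedness. *)
Record filtration (L : int -> set V) : Prop := Filtration {
  fl_0 : forall i, L i 0;
  fl_B : forall i u w, L i u -> L i w -> L i (u - w);
  fl_proper : forall i, L (i + 1) `<` L i;
  fl_exhaustive : forall u, exists i, L i u;
  fl_closed : forall (W : {vspace V}) u,
    (forall i, exists2 w, w \in W & L i (u - w)) -> u \in W;
  fl_bounded : forall y : A, exists d : nat,
    forall i u, L i u -> L (i - d%:Z) (y u) }.

(** With an equivalence, for invertible [g] this says that [g] maps [L i] onto [L (i + c)], and it
    passes to inverses. *)
Definition shifts (L : int -> set V) (g : A) (c : int) : Prop :=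
  forall i u, L (i + c) (g u) <-> L i u.

Definition chain_map (L : int -> set V) (K : set A) (k : int) : set A :=
  End_over K `&` [set x : A | forall i u, L i u -> L (i + k) (x u)].

(** [e] is the period of the chain over the integers of [K]: the nonzero elements of [K] have
    degrees in e Z, and [p] acts as a uniformiser. *)
Record chain_field (L : int -> set V) (K : set A) : Prop := ChainField {
  cf_field : is_field K;
  cf_scalars : @scalars F V `<=` K;
  cf_period : exists2 e : int, 0 < e & (exists2 p, K p & shifts L p e)
    /\ forall g, K g -> g <> 0 -> exists q : int, shifts L g (q * e) }.

Section Filtration.
Context (L : int -> set V) (L_fl : filtration L).

Lemma fl_N i u : L i u -> L i (- u).
Proof. by move=> Lu; rewrite -sub0r; apply: fl_B => //; apply: fl_0. Qed.

Lemma fl_D i u w : L i u -> L i w -> L i (u + w).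
Proof. by move=> Lu Lw; rewrite -[w]opprK; apply: fl_B => //; apply: fl_N. Qed.

Lemma fl_le i j : i <= j -> L j `<=` L i.
Proof. exact: chain_antitone (fl_proper L_fl) i j. Qed.

Lemma fl_jump j : exists2 w, L j w & ~ L (j + 1) w.
Proof.
have [_ Lnj] := fl_proper L_fl j; apply: contrapT => nex; apply: Lnj => w Lw.
by apply: contrapT => Lnw; apply: nex; exists w.
Qed.

Lemma fl_separated u : (forall i, L i u) -> u = 0.
Proof.
move=> Lu; apply/eqP; rewrite -memv0; apply: (fl_closed L_fl) => i.
by exists 0; rewrite ?memv0// subr0.
Qed.

Lemma fl_level u : u <> 0 -> exists2 j, L j u & ~ L (j + 1) u.
Proof.
move=> u0; have [i Liu] := fl_exhaustive L_fl u.
apply: contrapT => nex; apply: u0; apply: fl_separated => k.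
have step m : L (i + m%:Z) u.
  elim: m => [|m IHm]; first by rewrite addr0.
  apply: contrapT => Ln; apply: nex; exists (i + m%:Z) => //.
  by have -> : i + m%:Z + 1 = i + m.+1%:Z by lia.
by apply: (fl_le (j := i + `|k - i|%N%:Z)); [lia|apply: step].
Qed.

Lemma shifts_comp g h c d :
  shifts L g c -> shifts L h d -> shifts L (g \o h)%VF (c + d).
Proof.
move=> gc hd i u; rewrite comp_lfunE.
have -> : i + (c + d) = i + d + c by lia.
by rewrite gc hd.
Qed.

Lemma shifts_inv g h c : (g \o h)%VF = \1%VF -> shifts L g c -> shifts L h (- c).
Proof.
move=> gh gc i u; rewrite -(gc (i - c)) -comp_lfunE gh id_lfunE.
by have -> : i - c + c = i by lia.
Qed.

Lemma shifts_id : shifts L \1%VF 0.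
Proof. by move=> i u; rewrite addr0 id_lfunE. Qed.

Lemma field_shifts (K : set A) e p : is_field K -> K p -> shifts L p e -> forall q : int,
  exists g h, [/\ K g, K h, (g \o h)%VF = \1%VF & shifts L g (q * e)].
Proof.
move=> K_field Kp p_e; have [K0 K1 _ _ KM] := is_field_ops K_field.
have p0 : p <> 0.
  move=> p0; have [w Lw Lnw] := fl_jump 0; apply: Lnw; rewrite -(p_e 1).
  by rewrite p0 lfunE; apply: fl_0.
have [p' [Kp' pp' p'p]] := is_field_inv K_field Kp p0.
have pos (m : nat) : exists g h, [/\ K g, K h, (g \o h)%VF = \1%VF,
    (h \o g)%VF = \1%VF & shifts L g (m%:Z * e)].
  elim: m => [|m [g [h [Kg Kh gh hg g_s]]]].
    exists \1%VF, \1%VF; split=> //; rewrite ?comp_lfun1l// mul0r; exact: shifts_id.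
  exists (g \o p)%VF, (p' \o h)%VF; split; try exact: KM.
  - by rewrite comp_lfunA -(comp_lfunA g) pp' comp_lfun1r.
  - by rewrite comp_lfunA -(comp_lfunA p') hg comp_lfun1r.
  - have -> : m.+1%:Z * e = m%:Z * e + e by lia.
    exact: shifts_comp.
case=> m; have [g [h [Kg Kh gh hg g_s]]] := pos m.
  by exists g, h.
have {g h Kg Kh gh hg g_s} [g [h [Kg Kh gh hg g_s]]] := pos m.+1.
exists h, g; split=> //; have -> : Negz m * e = - (m.+1%:Z * e) by lia.
exact: shifts_inv gh g_s.
Qed.

(** * Operators of rank one and the powers of the radical *)

Section ChainField.
Context (K : set A) (cfK : chain_field L K).

Let K_field := cf_field cfK.
Let K0 : K 0. Proof. by case: (is_field_ops K_field). Qed.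
Let K1 : K \1%VF. Proof. by case: (is_field_ops K_field). Qed.
Let KD x y : K x -> K y -> K (x + y).
Proof. by case: (is_field_ops K_field) => _ _ + _ _; apply. Qed.
Let KB x y : K x -> K y -> K (x - y).
Proof. by case: (is_field_ops K_field) => _ _ _ + _; apply. Qed.
Let KM x y : K x -> K y -> K (x \o y)%VF.
Proof. by case: (is_field_ops K_field) => _ _ _ _; apply. Qed.
Let Kscal a : K (a *: \1%VF).
Proof. by apply: (cf_scalars cfK); exists a. Qed.

Lemma vspace_addK (W : {vspace V}) u : exists U : {vspace V},
  forall t, (t \in U) <-> (exists x g, [/\ x \in W, K g & t = x + g u]).
Proof.
apply: (@vspace_of_subset [set t | _]) => /= [|a t1 t2].
  by exists 0, 0; rewrite mem0v lfunE addr0.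
move=> [x1 [g1 [x1W Kg1 ->]]] [x2 [g2 [x2W Kg2 ->]]].
exists (a *: x1 + x2), ((a *: \1%VF) \o g1 + g2)%VF; split.
- by rewrite memvD// memvZ.
- by apply: KD => //; apply: KM.
- by rewrite !lfun_simp scalerDr addrACA.
Qed.

(* [T w'] is the operator [u |-> lam(u) w'], where [lam : V -> K] is a K-linear
   form with [lam w = 1] that is as integral on the chain as [lam w = 1] allows.
   The kernel of [lam] is a K-subspace [W] maximal for [w \notin W + L (j + 1)]:
   by maximality [L (j + 1 - e)] is contained in [oK w + W + L (j + 1)]. *)
Lemma rank_one j w : L j w -> ~ L (j + 1) w ->
  exists T : V -> A,
  [/\ forall m w', L (j + m) w' -> chain_map L K m (T w'),
      forall w', T w' w = w',
      forall y w', End_over K y -> (y \o T w')%VF = T (y w') &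
      forall w' u, exists2 g, K g & T w' u = g w'].
Proof.
move=> Ljw Lnw.
have [e e_gt0 [[p Kp p_e] K_val]] := cf_period cfK.
pose good (W : {vspace V}) := (forall g u, K g -> u \in W -> g u \in W) /\
  forall u, u \in W -> ~ L (j + 1) (w - u).
have good0 : good 0%VS.
  split=> [g u _|u]; rewrite memv0 => /eqP->; first by rewrite linear0 mem0v.
  by rewrite subr0.
have [W [W_K W_w] W_max] := maximal_vspace good0.
pose oK g := forall i u, L i u -> L i (g u).
have oK_shift g (q : int) : shifts L g (q * e) -> 0 <= q -> oK g.
  move=> g_s q0 i u Lu; apply: (fl_le (j := i + q * e)); first by nia.
  by rewrite g_s.
have approx u : L (j + 1 - e) u -> exists g x,
    [/\ K g, oK g, x \in W & L (j + 1) (u - g w - x)].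
  move=> Lu; apply: contrapT => nex.
  have uW : u \notin W.
    apply/negP => uW; apply: nex; exists 0, u; split=> //.
      by move=> i t _; rewrite lfunE; apply: fl_0.
    by rewrite lfunE subr0 subrr; apply: fl_0.
  have [W' W'P] := vspace_addK W u.
  have : ~ (\dim W' <= \dim W)%N.
    move=> dW'; have WW' : (W <= W')%VS.
      apply/subvP => t tW; apply/W'P; exists t, 0; split=> //.
      by rewrite lfunE addr0.
    have /eqP eqWW' : W == W' by rewrite eqEdim WW'.
    move/negP: uW; apply; rewrite eqWW'; apply/W'P; exists 0, \1%VF.
    by rewrite mem0v lfunE add0r.
  apply; apply: W_max; split.
    move=> g t Kg /W'P[x [h [xW Kh ->]]]; apply/W'P.
    exists (g x), (g \o h)%VF; split; [exact: W_K|exact: KM|].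
    by rewrite linearD comp_lfunE.
  move=> t /W'P[x [g [xW Kg ->]]] Lg.
  have g0 : g <> 0.
    by move=> g0; apply: (W_w x xW); move: Lg; rewrite g0 lfunE addr0.
  have [q g_s] := K_val g Kg g0.
  have [h [Kh gh hg]] := is_field_inv K_field Kg g0.
  (* A positive degree would put [g u] in [L (j + 1)], and [x] alone would approximate [w]. So [g]
     has degree at most 0, its inverse [h] is integral, and applying [h] to the approximation of [w]
     yields one of [u]. *)
  have [q_gt0|q_le0] := ltrP 0 q.
    apply: (W_w x xW); have -> : w - x = (w - (x + g u)) + g u.
      by rewrite opprD addrA addrNK.
    apply: fl_D => //; apply: (fl_le (j := j + 1 - e + q * e)); first by nia.
    by rewrite g_s.
  have h_s := shifts_inv gh g_s.
  apply: nex; exists h, (- h x); split=> //.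
  - by apply: (@oK_shift h (- q)); [rewrite mulNr|lia].
  - by rewrite memvN W_K.
  - have -> : u - h w - - h x = - h (w - (x + g u)).
      rewrite [h (w - _)]linearB /= [h (x + _)]linearD /= -[h (g u)]comp_lfunE hg id_lfunE.
      by rewrite !opprB opprK [h x + u]addrC [RHS]addrAC.
    apply: fl_N; apply: (fl_le (j := j + 1 + - (q * e))); first by nia.
    by rewrite h_s.
have W_inj g x : K g -> x \in W -> g w + x = 0 -> g = 0.
  move=> Kg xW gwx; apply: contrapT => g0.
  have [h [Kh gh hg]] := is_field_inv K_field Kg g0.
  have wE : w = - h x.
    have := congr1 h gwx; rewrite linear0 linearD /= -comp_lfunE hg id_lfunE.
    by move/eqP; rewrite addr_eq0 => /eqP.
  apply: (W_w w); last by rewrite subrr; apply: fl_0.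
  by rewrite {1}wE memvN W_K.
have [W' W'P] := vspace_addK W w.
(* Rescaling [approx] by an element of degree [q * e] shows that subtracting a suitable element of
   [W' = W + K w] gains a full period. *)
have step (q : int) u : L (j + 1 - e + q * e) u ->
    exists2 z, z \in W' & L (j + 1 - e + q * e + e) (u - z).
  have [g [h [Kg Kh gh g_s]]] := field_shifts K_field Kp p_e q => Lu.
  have uE : u = g (h u) by rewrite -comp_lfunE gh id_lfunE.
  have /approx[g' [x [Kg' _ xW Lx]]] : L (j + 1 - e) (h u) by rewrite -g_s -uE.
  exists (g (g' w + x)).
    apply/W'P; exists (g x), (g \o g')%VF; split; [exact: W_K|exact: KM|].
    by rewrite linearD addrC comp_lfunE.
  rewrite {1}uE -linearB /= opprD addrA.
  have -> : j + 1 - e + q * e + e = j + 1 + q * e by lia.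
  by rewrite g_s.
(* By iteration [u] is a limit of elements of [W'], and subspaces are closed; hence V = W + K w. *)
have W'T u : u \in W'.
  apply: (fl_closed L_fl) => i.
  have [i0 Lu] := fl_exhaustive L_fl u.
  pose q := - (`|j + 1 - e - i0|).
  have Lqu : L (j + 1 - e + q * e) u by apply: fl_le Lu; rewrite /q; nia.
  have steps (m : nat) : exists2 z, z \in W' & L (j + 1 - e + (q + m%:Z) * e) (u - z).
    elim: m => [|m [z zW' Lz]].
      by exists 0; rewrite ?mem0v// addr0 subr0.
    have [z' z'W' Lz'] := step _ _ Lz; exists (z + z'); first exact: memvD.
    rewrite opprD addrA; move: Lz'.
    by have -> : j + 1 - e + (q + m%:Z) * e + e = j + 1 - e + (q + m.+1%:Z) * e by lia.
  have [z zW' Lz] := steps (absz (i - (j + 1 - e + q * e))%R); exists z => //.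
  by apply: fl_le Lz; nia.
have /choice[lam lamP] u : exists g, K g /\ u - g w \in W.
  have /W'P[x [g [xW Kg ->]]] := W'T u; exists g; split=> //.
  by rewrite addrK.
have lam_uniq g u : K g -> u - g w \in W -> lam u = g.
  have [Klam lamW] := lamP u; move=> Kg gW; apply/eqP; rewrite -subr_eq0; apply/eqP.
  apply: (@W_inj _ ((u - lam u w) - (u - g w))); [exact: KB|exact: memvB|].
  rewrite !lfun_simp opprB [u - _ + _]addrC [_ - u + _]addrA addrNK.
  by rewrite addrA addrNK subrr.
have lamw : lam w = \1%VF by apply: lam_uniq; rewrite // id_lfunE subrr mem0v.
have lam_lin g u u' : K g -> lam (g u + u') = (g \o lam u + lam u')%VF.
  have [[Ku uW] [Ku' uW']] := (lamP u, lamP u').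
  move=> Kg; apply: lam_uniq; first by apply: KD => //; apply: KM.
  rewrite !lfun_simp opprD addrACA -linearB /= memvD// W_K//.
have lam_K g u : K g -> lam (g u) = (g \o lam u)%VF.
  move=> Kg; rewrite -[g u]addr0 lam_lin// [lam 0](_ : _ = 0) ?addr0//.
  by apply: lam_uniq; rewrite // lfunE subrr mem0v.
have lam_bound k m u w' : L k u -> L (j + m) w' -> L (k + m) (lam u w').
  move=> Lu Lw'; pose a := k - (j + 1 - e).
  have [t_ge0 t_lt] : 0 <= (a %% e)%Z /\ (a %% e)%Z < e.
    by split; [rewrite modz_ge0; lia|rewrite ltz_pmod].
  have aE := divz_eq a e; set q := (a %/ e)%Z in aE; set t := (a %% e)%Z in aE t_ge0 t_lt.
  have [g [h [Kg Kh gh g_s]]] := field_shifts K_field Kp p_e q.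
  have uE : u = g (h u) by rewrite -comp_lfunE gh id_lfunE.
  have /approx[g' [x [Kg' og' xW Lx]]] : L (j + 1 - e) (h u).
    by rewrite -g_s -uE; apply: fl_le Lu; rewrite /a in aE; lia.
  rewrite uE lam_K// comp_lfunE.
  have [Khu huW] := lamP (h u).
  have o_hu : L (j + m) (lam (h u) w').
    have [d0|d0] := eqVneq (lam (h u)) g'; first by rewrite d0; apply: og'.
    have d0' : lam (h u) - g' <> 0 by apply/eqP; rewrite subr_eq0.
    have Kd : K (lam (h u) - g') by apply: KB.
    have [q' d_s] := K_val _ Kd d0'.
    rewrite -[lam _](subrK g') add_lfunE; apply: fl_D; last exact: og'.
    (* If [lam (h u) - g'] had negative degree, its inverse would raise levels, and [w] would be
       congruent to an element of [W] modulo [L (j + 1)], against [W_w]. *)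
    have [q'0|q'0] := lerP 0 q'; first exact: oK_shift d_s q'0 _ _ Lw'.
    have [i [Ki di id_]] := is_field_inv K_field Kd d0'.
    have i_s := shifts_inv di d_s.
    exfalso; apply: (W_w (i (x - (h u - lam (h u) w)))).
      by rewrite W_K// memvB.
    have {1}-> : w = i ((lam (h u) - g') w) by rewrite -comp_lfunE id_ id_lfunE.
    rewrite -linearB /=; apply: (fl_le (j := j + 1 + - (q' * e))); first by nia.
    rewrite i_s; move: Lx; rewrite !lfun_simp.
    by rewrite !opprB !addrA [_ - _ + h u]addrC [_ - lam _ _]addrAC addrA addrNK.
  (* The remainder [t] is at most [e - 1], so [q * e >= k - j]: this is why [approx] starts at level
     [j + 1 - e]. *)
  apply: (fl_le (j := j + m + q * e)); first by rewrite /a in aE; lia.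
  by rewrite g_s.
have /choice[T TP] w' : exists y : A, forall u, y u = lam u w'.
  apply: lfun_of_linear => a u u'.
  have -> : a *: u = (a *: \1%VF : A) u by rewrite !lfun_simp.
  by rewrite lam_lin// !lfun_simp.
exists T; split.
- move=> m w' Lw'; split=> [k Kk|i u Lu]; last by rewrite TP; apply: lam_bound.
  by apply/lfunP => u; rewrite !comp_lfunE !TP lam_K// comp_lfunE.
- by move=> w'; rewrite TP lamw id_lfunE.
- move=> y w' Ky; apply/lfunP => u; rewrite comp_lfunE !TP.
  by rewrite -comp_lfunE Ky ?comp_lfunE//; case: (lamP u).
- by move=> w' u; exists (lam u); [case: (lamP u)|rewrite TP].
Qed.

Lemma chain_map_le k l : k <= l -> chain_map L K l `<=` chain_map L K k.
Proof.
move=> le_kl x [Kx Lx]; split=> // i u Lu.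
by apply: (fl_le (j := i + l)); [lia|apply: Lx].
Qed.

Lemma chain_map0 k : chain_map L K k 0.
Proof. by split=> [|i u _]; [exact: End_over0|rewrite lfunE; apply: fl_0]. Qed.

Lemma chain_mapB k x y :
  chain_map L K k x -> chain_map L K k y -> chain_map L K k (x - y).
Proof.
move=> [Kx Lx] [Ky Ly]; split=> [|i u Lu]; first exact: End_overB.
by rewrite !lfun_simp; apply: fl_B => //; [apply: Lx|apply: Ly].
Qed.

Lemma chain_mapD k x y :
  chain_map L K k x -> chain_map L K k y -> chain_map L K k (x + y).
Proof.
move=> [Kx Lx] [Ky Ly]; split=> [|i u Lu]; first exact: End_overD.
by rewrite !lfun_simp; apply: fl_D => //; [apply: Lx|apply: Ly].
Qed.

Lemma chain_map_comp k l x y :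
  chain_map L K k x -> chain_map L K l y -> chain_map L K (k + l) (x \o y)%VF.
Proof.
move=> [Kx Lx] [Ky Ly]; split=> [|i u Lu]; first exact: End_over_comp.
by rewrite comp_lfunE addrCA addrC; apply: Lx; apply: Ly.
Qed.

Lemma chain_map_compl k x y :
  chain_map L K 0 x -> chain_map L K k y -> chain_map L K k (x \o y)%VF.
Proof. by rewrite -{2}[k]add0r; apply: chain_map_comp. Qed.

Lemma chain_map_id : chain_map L K 0 \1%VF.
Proof. by split=> [|i u Lu]; [exact: End_over_id|rewrite addr0 id_lfunE]. Qed.

(** A vector killed by [\1 + z] would lie in every [L i], so [\1 + z] is injective, hence
    invertible. Its inverse [y] lowers levels by at most some [d], and [y = \1 - y z] improves this
    bound one level at a time until it is 0. *)
Lemma chain_map_inv z : chain_map L K 1 z -> exists y, [/\ chain_map L K 0 y,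
  ((\1 + z) \o y)%VF = \1%VF & (y \o (\1 + z))%VF = \1%VF].
Proof.
move=> [Kz Lz].
have ker0 : lker (\1 + z)%VF == 0%VS.
  rewrite -subv0; apply/subvP => u; rewrite memv_ker memv0 add_lfunE id_lfunE.
  rewrite addr_eq0 => /eqP uE; apply/eqP/fl_separated => i.
  have [i0 Lu] := fl_exhaustive L_fl u.
  have steps (m : nat) : L (i0 + m%:Z) u.
    elim: m => [|m IHm]; first by rewrite addr0.
    rewrite uE; apply: fl_N => //.
    by rewrite (_ : i0 + m.+1%:Z = i0 + m%:Z + 1); [apply: Lz|lia].
  by apply: (fl_le (j := i0 + (absz (i - i0))%:Z)); [lia|apply: steps].
have := lker0_compVf ker0; have := lker0_compfV ker0.
set y := (_^-1)%VF => zy yz; exists y; split=> //; split.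
  apply: End_over_inv zy yz; apply: End_overD => //; exact: End_over_id.
move=> i u Lu; have [d y_d] := fl_bounded L_fl y.
have yE u' : y u' = u' - y (z u').
  have /(congr1 (fun f : A => f u')) := yz.
  by rewrite comp_lfunE add_lfunE !id_lfunE linearD /= => {2}<-; rewrite addrK.
(* [m] is the number of levels by which [u'] may fall short of [L (i + d)], where the crude bound is
   enough. *)
have steps (m : nat) u' : L (i + d%:Z - m%:Z) u' -> (m <= d)%N -> L i u' -> L i (y u').
  elim: m u' => [|m IHm] u' Lu' le_m Liu'.
    by have := y_d _ _ Lu'; rewrite (_ : i + d%:Z - 0%N%:Z - d%:Z = i); [|lia].
  rewrite yE; apply: fl_B => //; apply: IHm; last 2 first.
  - exact: ltnW.
  - by apply: (fl_le (j := i + 1)); [lia|apply: Lz].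
  - by rewrite (_ : i + d%:Z - m%:Z = i + d%:Z - m.+1%:Z + 1); [apply: Lz|lia].
by rewrite addr0; apply: (steps d) => //; rewrite (_ : i + d%:Z - d%:Z = i); [|lia].
Qed.

(* Splitting off rank one operators one at a time, each being a product of an
   operator raising the level by [a] and one lowering it by [a]. *)
Lemma mulspan_id a : mulspan comp (chain_map L K a) (chain_map L K (- a)) \1%VF.
Proof.
set I := mulspan _ _ _.
have I_r x y : I x -> chain_map L K 0 y -> I (x \o y)%VF.
  move=> Ix Hy; pose S := [set x : A | I (x \o y)%VF].
  apply: (mulspan_min (S := S) _ _ _ Ix); rewrite /S /=.
  - by rewrite comp_lfun0l; apply: mulspan0.
  - by move=> z z' Iz Iz'; rewrite comp_lfunDl; apply: mulspanD.
  - move=> z z' Hz Hz'; rewrite -comp_lfunA; apply: mulspan_mul => //.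
    by rewrite -[- a]addr0; apply: chain_map_comp.
suff main d p : chain_map L K 0 p -> (\dim (limg p) <= d)%N -> I p.
  exact: main _ chain_map_id (leqnn _).
elim: d p => [|d IHd] p Hp dim_p.
  have -> : p = 0; last exact: mulspan0.
  apply/lfunP => u; rewrite lfunE; apply/eqP; rewrite -memv0.
  have /eqP <- : limg p == 0%VS by rewrite -dimv_eq0 -leqn0.
  exact/memv_img/memvf.
have [->|p0] := eqVneq p 0; first exact: mulspan0.
have [u pu0] : exists u, p u <> 0.
  apply: contrapT => nex; move/eqP: p0; apply; apply/lfunP => u.
  by rewrite lfunE; apply: contrapT => pu; apply: nex; exists u.
set w := p u in pu0.
have [j Lw Lnw] := fl_level pu0.
have [T [T_lev Tw T_l T_K]] := rank_one Lw Lnw.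
have [w' Lw' Lnw'] := fl_jump (j - a).
have [T' [T'_lev T'w' T'_l _]] := rank_one Lw' Lnw'.
have HTw : chain_map L K 0 (T w) by apply: T_lev; rewrite addr0.
have -> : p = (T w \o p)%VF + (p - (T w \o p)%VF) by rewrite addrC subrK.
apply: mulspanD.
  apply: I_r => //.
  have HT'w : chain_map L K a (T' w) by apply: T'_lev; rewrite subrK.
  (* [T w'] lowers levels by [a], and [T' w] raises them by [a] and sends [w'] to [w]. *)
  have <- : (T' w \o T w')%VF = T w by rewrite T_l ?T'w'//; case: HT'w.
  by apply: mulspan_mul => //; apply: T_lev.
apply: IHd; first by apply: chain_mapB => //; apply: chain_map_compl.
rewrite -ltnS; apply: leq_trans dim_p.
(* The values of [T w] are multiples of [w = p u] by elements of [K], and [p] is K-linear. *)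
have sub_img : (limg (p - (T w \o p)%VF) <= limg p)%VS.
  apply/subvP => _ /memv_imgP[x _ ->]; rewrite !lfun_simp; apply: memvB.
    exact/memv_img/memvf.
  have [g Kg ->] := T_K w (p x).
  by rewrite /w -(End_overE _ Hp.1 Kg); apply/memv_img/memvf.
(* The image gets strictly smaller: the idempotent [T w] kills the image of [p - T w p] but fixes
   the nonzero vector [w]. *)
rewrite ltnNge (geq_leqif (dimv_leqif_sup sub_img)); apply/negP => /subvP/(_ w).
case/(_ (memv_img _ (memvf _)))/memv_imgP => x _ wE; apply: pu0.
have TT : (T w \o T w)%VF = T w by rewrite T_l ?Tw//; case: HTw.
have <- : T w w = w := Tw w; rewrite {2}wE !(add_lfunE, opp_lfunE, comp_lfunE) linearB /=.
by rewrite -(comp_lfunE (T w) (T w)) TT subrr.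
Qed.

(** To reach every [x] of degree [a + c], multiply it by 1, written with [mulspan_id] as a sum of
    products of maps of degrees [- c] and [c]. *)
Lemma mulspan_chain_map a c :
  mulspan comp (chain_map L K a) (chain_map L K c) = chain_map L K (a + c).
Proof.
apply/seteqP; split=> [|x Hx].
  apply: mulspan_min; [exact: chain_map0|exact: chain_mapD|exact: chain_map_comp].
have := mulspan_id (- c); rewrite opprK => -[m [y [z [Hy Hz /(congr1 (comp x))]]]].
rewrite comp_lfun1r => ->; rewrite (big_morph _ (comp_lfunDr x) (comp_lfun0r _ x)).
under eq_bigr => i _ do rewrite comp_lfunA.
apply: mulspan_sum => // i.
by rewrite -[a](addrK c); apply: chain_map_comp.
Qed.

(** If [x] does not raise the level of some [w] in [L j], the maps of degree 0 sending [w] into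
    [L (j + 1)] form a maximal left ideal without [x]. Conversely, a maximal left ideal missing an
    [x] of degree 1 would contain some 1 - c x, which is a unit. *)
Lemma jacobson_chain_map : jacobson_radical (chain_map L K 0) = chain_map L K 1.
Proof.
apply/seteqP; split=> x.
  move=> [Hx x_max]; split=> [|j w Lw]; first exact: Hx.1.
  apply: contrapT => Lnx.
  have Lnw : ~ L (j + 1) w.
    by move=> Lw'; apply: Lnx; rewrite -[j + 1]addr0; apply: Hx.2.
  have Hw c : chain_map L K 0 c -> L j (c w).
    by move=> Hc; rewrite -[j]addr0; apply: Hc.2.
  pose I := chain_map L K 0 `&` [set y : A | L (j + 1) (y w)].
  suff /x_max[] : maximal_left_ideal (chain_map L K 0) I by [].
  split.
  - split=> [y []//||y z [Hy Ly] [Hz Lz]|c y Hc [Hy Ly]].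
    + by split; [exact: chain_map0|rewrite /= lfunE; apply: fl_0].
    + by split; [exact: chain_mapB|rewrite /= !lfun_simp; apply: fl_B].
    + split; [exact: chain_map_compl|rewrite /= comp_lfunE].
      by rewrite -[j + 1]addr0; apply: Hc.2.
  - by move=> IE; have := chain_map_id; rewrite -IE => -[_ /=]; rewrite id_lfunE.
  - move=> J [J_sub J0 JB JM] IJ.
    have [|nJI] := pselect (J `<=` I); first by move=> JI; left; apply/seteqP.
    right; apply/seteqP; split=> // c Hc.
    have [y Jy Lny] : exists2 y, J y & ~ L (j + 1) (y w).
      apply: contrapT => nex; apply: nJI => y Jy; split; first exact: J_sub.
      by apply: contrapT => Ly; apply: nex; exists y.
    have Hy := J_sub _ Jy.
    (* [T w] sends [y w] back to [w], so [\1 - T w y] lies in [I] and [T w y] in [J]; thus 1 is in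
       [J]. *)
    have [T [T_lev Tw _ _]] := rank_one (Hw _ Hy) Lny.
    have HT : chain_map L K 0 (T w) by apply: T_lev; rewrite addr0.
    rewrite -[c]comp_lfun1r; apply: (JM) => //.
    rewrite -(subrK (T w \o y)%VF \1%VF) -[X in _ + X]opprK; apply: (JB).
      apply: IJ; split; first by apply: chain_mapB; [exact: chain_map_id|exact: chain_map_compl].
      by rewrite /= add_lfunE opp_lfunE id_lfunE comp_lfunE Tw subrr; apply: fl_0.
    by rewrite -sub0r; apply: JB => //; apply: JM.
move=> Hx; have Hx0 : chain_map L K 0 x by apply: chain_map_le Hx.
split=> // I [[I_sub I0 IB IM] I_ne I_max].
have ID y z : I y -> I z -> I (y + z).
  by move=> Iy Iz; rewrite -[z]opprK -[- z]sub0r; apply: (IB) => //; apply: IB.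
apply: contrapT => nIx.
pose J := [set z : A | exists i c, [/\ I i, chain_map L K 0 c & z = i + (c \o x)%VF]].
have J_left : left_ideal (chain_map L K 0) J.
  split.
  - move=> _ [i [c [Ii Hc ->]]]; apply: chain_mapD; first exact: I_sub.
    exact: chain_map_compl.
  - by exists 0, 0; split; [|exact: chain_map0|rewrite comp_lfun0l addr0].
  - move=> _ _ [i [c [Ii Hc ->]]] [i' [c' [Ii' Hc' ->]]].
    exists (i - i'), (c - c'); split; [exact: IB|exact: chain_mapB|].
    by rewrite opprD addrACA comp_lfunDl comp_lfunNl.
  - move=> a _ Ha [i [c [Ii Hc ->]]]; exists (a \o i)%VF, (a \o c)%VF.
    split; [exact: IM|exact: chain_map_compl|].
    by rewrite comp_lfunDr comp_lfunA.
have [||JE] := I_max J J_left.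
- by move=> i Ii; exists i, 0; split=> //; [exact: chain_map0|rewrite comp_lfun0l addr0].
- move=> JE; apply: nIx; rewrite -JE; exists 0, \1%VF.
  by split=> //; [exact: chain_map_id|rewrite comp_lfun1l add0r].
have : J \1%VF by rewrite JE; exact: chain_map_id.
move=> [i [c [Ii Hc idE]]].
have Hcx : chain_map L K 1 (- (c \o x)%VF).
  by rewrite -sub0r; apply: chain_mapB; [exact: chain_map0|exact: chain_map_compl].
have [y [Hy _ yi]] := chain_map_inv Hcx.
apply: I_ne; apply/seteqP; split=> // z Hz.
rewrite -[z]comp_lfun1r -yi; apply: (IM) => //; apply: IM => //.
by rewrite idE addrK.
Qed.

Lemma ideal_exp_chain_map m :
  ideal_exp (chain_map L K 0) (jacobson_radical (chain_map L K 0)) m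
    = chain_map L K m%:Z.
Proof.
elim: m => [//|m /= ->]; rewrite jacobson_chain_map mulspan_chain_map.
by congr (chain_map L K _); lia.
Qed.

(** For a negative exponent, expand 1 as a sum of products [y z] with [y] of degree m+1 and [z] of
    degree -(m+1): each [x y] has degree 0 by the definition of the inverse ideal. *)
Lemma rad_exp_chain_map k : rad_exp K (chain_map L K 0) k = chain_map L K k.
Proof.
case: k => m; first exact: ideal_exp_chain_map.
rewrite /rad_exp ideal_exp_chain_map.
apply/seteqP; split=> x.
  move=> [Kx x_l]; have [q [y [z [Hy Hz idE]]]] := mulspan_id m.+1%:Z.
  rewrite -[x]comp_lfun1r idE (big_morph _ (comp_lfunDr x) (comp_lfun0r _ x)).
  apply: big_ind => [||i _]; [exact: chain_map0|exact: chain_mapD|].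
  rewrite comp_lfunA; apply: chain_map_compl; first exact: x_l.
  by have -> : Negz m = - m.+1%:Z by []; apply: Hz.
move=> Hx; split=> [|y Hy]; first exact: Hx.1.
have -> : (0 : int) = Negz m + m.+1%:Z by lia.
exact: chain_map_comp.
Qed.

End ChainField.

(** * The normaliser of the order shifts the filtration *)

Section Normaliser.
Hypothesis cf0 : chain_field L (@scalars F V).
Local Notation R := (chain_map L (@scalars F V) 0).

Let conj_closed (g h : A) := [/\ (g \o h)%VF = \1%VF, (h \o g)%VF = \1%VF &
  forall y, R y -> R (h \o y \o g)%VF].

(** The preimage of [L j] under [h] is stable under the order. Take [m] largest with this preimage
    inside [L m]: an element [w] of it outside [L (m + 1)] is carried to any element of [L m] by a
    rank one operator of degree 0, so the preimage is all of [L m]. *)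
Let conj_level g h : conj_closed g h ->
  forall j, exists m, forall u, L j (h u) <-> L m u.
Proof.
move=> [gh hg Rhg] j.
have [u0 Lu0 Lnu0] := fl_jump j.
have [d g_d] := fl_bounded L_fl g.
have gu0 : g u0 <> 0.
  move=> gu0; apply: Lnu0; have -> : u0 = 0; last exact: fl_0.
  by rewrite -[u0]id_lfunE -hg comp_lfunE gu0 linear0.
have [m0 _ Lnm0] := fl_level gu0.
pose sub m := forall u, L j (h u) -> L m u.
have sub_d : sub (j - d%:Z).
  by move=> u /g_d; rewrite -comp_lfunE gh id_lfunE.
(* [g u0] lies in the preimage but not in [L (m0 + 1)]. *)
have sub_lt m : sub m -> m < m0 + 1.
  move=> /(_ (g u0)); rewrite -comp_lfunE hg id_lfunE => /(_ Lu0).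
  by rewrite ltNge => Lm; apply/negP => /fl_le/(_ _ Lm).
have [m sub_m sub_m1] : exists2 m, sub m & ~ sub (m + 1).
  apply: contrapT => nex.
  have step (k : nat) : sub (j - d%:Z + k%:Z).
    elim: k => [|k IHk]; first by rewrite addr0.
    apply: contrapT => Ln; apply: nex; exists (j - d%:Z + k%:Z) => //.
    by rewrite (_ : _ + 1 = j - d%:Z + k.+1%:Z); [|lia].
  by have := sub_lt _ (step (absz (m0 + 1 - (j - d%:Z))%R)); lia.
exists m => u; split=> [|Lu]; first exact: sub_m.
have [w Lw Lnw] : exists2 w, L j (h w) & ~ L (m + 1) w.
  apply: contrapT => nex; apply: sub_m1 => w Lw.
  by apply: contrapT => Lnw; apply: nex; exists w.
have [T [T_lev Tw _ _]] := rank_one cf0 (sub_m _ Lw) Lnw.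
have RT : R (T u) by apply: T_lev; rewrite addr0.
have [_ hTg] := Rhg _ RT.
have := hTg _ _ Lw; rewrite addr0 !comp_lfunE -[g (h w)]comp_lfunE gh id_lfunE.
by rewrite Tw.
Qed.

(** Let f j be the index with g L_j = L_(f j): f is increasing and without gaps, hence a
    translation. *)
Lemma normaliser_shifts g : normaliser (@scalars F V) R g ->
  exists c, shifts L g c.
Proof.
case=> h [_ _ gh hg RE].
have gh_closed : conj_closed g h.
  split=> // y; rewrite -{1}RE => -[x Rx <-].
  by rewrite !comp_lfunA hg comp_lfun1l -comp_lfunA hg comp_lfun1r.
have hg_closed : conj_closed h g by split=> // y Ry; rewrite -RE; exists y.
have /choice[f fP] := conj_level gh_closed.
have f_lt i j : i < j -> f i < f j.
  move=> lt_ij; rewrite ltNge; apply/negP => le_f.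
  have [u Lu Lnu] := fl_jump i; apply: Lnu.
  have uE : h (g u) = u by rewrite -comp_lfunE hg id_lfunE.
  apply: (fl_le (j := j)); first by lia.
  by rewrite -uE fP; apply: fl_le le_f _ _; rewrite -fP uE.
(* [L (f i + 1)] is itself the image under [g] of some [L l] with [i < l], hence is contained in
   [L (f (i + 1))]; so [f] cannot jump by more than 1. *)
have fS i : f (i + 1) = f i + 1.
  have [l lP] := conj_level hg_closed (f i + 1).
  have lt_fi : f i < f (i + 1) by apply: f_lt; lia.
  apply/eqP; rewrite eq_le; apply/andP; split; last by lia.
  rewrite leNgt; apply/negP => lt_f.
  have il : i < l.
    rewrite ltNge; apply/negP => le_li; have [u Lu Lnu] := fl_jump (f i).
    apply: Lnu; have uE : g (h u) = u by rewrite -comp_lfunE gh id_lfunE.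
    by rewrite -uE lP; apply: fl_le le_li _ _; rewrite fP.
  have [u Lu Lnu] := fl_jump (f i + 1).
  have uE : g (h u) = u by rewrite -comp_lfunE gh id_lfunE.
  apply: Lnu; apply: (fl_le (j := f (i + 1))); first by lia.
  rewrite -fP; apply: (fl_le (j := l)); first by lia.
  by rewrite -lP uE.
have fE i : f i = f 0 + i.
  have fN (m : nat) : f (- m%:Z) = f 0 - m%:Z.
    elim: m => [|m IHm]; first by rewrite !subr0.
    by have := fS (- m.+1%:Z); rewrite (_ : _ + 1 = - m%:Z); lia.
  case: i => m; last exact: (fN m.+1).
  elim: m => [|m IHm]; first by rewrite addr0.
  by have := fS m%:Z; rewrite (_ : _ + 1 = m.+1%:Z); lia.
exists (f 0) => i u; rewrite addrC -fE -fP.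
by rewrite -comp_lfunE hg id_lfunE.
Qed.

(** The degrees of the nonzero elements of [K] form a subgroup of Z, nonzero because of the scalars;
    [e] is its least positive element, and Euclidean division shows that it generates. *)
Lemma chain_field_of_normaliser (K : set A) : is_field K -> @scalars F V `<=` K ->
  K `\ 0 `<=` normaliser (@scalars F V) R -> chain_field L K.
Proof.
move=> K_field sK K_norm; split=> //.
have K_sh g : K g -> g <> 0 -> exists c, shifts L g c.
  by move=> Kg g0; apply: normaliser_shifts; apply: K_norm.
have [_ _ _ _ KM] := is_field_ops K_field.
have [e0 e0_gt0 [[p0 p0_s p0_e] _]] := cf_period cf0.
pose P c := (0 < c)%N && `[< exists2 g, K g & shifts L g c%:Z >].
have P_ex : exists c, P c.
  exists (absz e0); apply/andP; split; first by lia.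
  by apply/asboolP; exists p0; [exact: sK|rewrite gtz0_abs].
case: (ex_minnP P_ex) => e /andP[e_gt0 /asboolP[p Kp p_e]] e_min.
exists e%:Z; [by []|split; first by exists p].
move=> g Kg g0; have [c g_c] := K_sh g Kg g0; exists (c %/ e)%Z.
have [a [b [Ka Kb ab a_s]]] := field_shifts K_field Kp p_e (- (c %/ e)%Z).
have ga_s := shifts_comp g_c a_s.
suff -> : (c %/ e)%Z * e = c by [].
have cE := divz_eq c e; have t_ge0 : 0 <= (c %% e)%Z by rewrite modz_ge0; lia.
have t_lt : (c %% e)%Z < e by rewrite ltz_pmod.
have [t0|t_gt0] : (c %% e)%Z = 0 \/ (0 < absz (c %% e)%Z)%N by lia.
  by rewrite {2}cE t0 addr0.
suff /e_min : P (absz (c %% e)%Z) by lia.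
rewrite /P t_gt0; apply/asboolP; exists (g \o a)%VF; first exact: KM.
by move: ga_s; rewrite gez0_abs// (_ : c + _ = (c %% e)%Z); [|lia].
Qed.

End Normaliser.
End Filtration.

(** * The valuation ring of F inside the scalars *)

Section LocalField.
Context (v : F -> \bar int) (F_local : nonarch_local_field v).
Hypothesis id_neq0 : \1%VF <> 0 :> A.
Local Notation vge k x := ((k : int)%:E <= v x)%E.

Let vge0 k : vge k 0.
Proof. by rewrite (lf_val0 F_local 0).2// leey. Qed.

Let vgeM k l x y : vge k x -> vge l y -> vge (k + l) (x * y).
Proof. by move=> kx ly; rewrite (lf_valM F_local) EFinD; apply: leeD. Qed.

Let vgeD k x y : vge k x -> vge k y -> vge k (x + y).
Proof.
move=> kx ky; apply: le_trans (lf_valD F_local x y).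
by rewrite le_min kx ky.
Qed.

Let val_inv x : x != 0 -> exists k : int, v x = k%:E%E /\ v x^-1 = (- k)%:E%E.
Proof.
have [pi pi1] := lf_uniformizer F_local.
(* The finite value of [pi] can be cancelled in v(pi 1) = v(pi) + v(1). *)
have v1 : v 1 = 0%E.
  have := lf_valM F_local pi 1; rewrite mulr1 pi1.
  by case: (v 1) => [k [] k0||] //; congr (_%:E)%E; lia.
move=> x0; have := lf_valM F_local x x^-1; rewrite divff// v1.
have : v x <> +oo%E by move=> /(lf_val0 F_local) /eqP; apply/negP.
have : v x^-1 <> +oo%E.
  by move=> /(lf_val0 F_local) /eqP; rewrite invr_eq0; apply/negP.
case: (v x) (v x^-1) => [k| |] [l| |] //= _ _ [kl].
by exists k; split=> //; congr (_%:E)%E; lia.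
Qed.

Let val1 : v 1 = 0%E.
Proof.
have [k [vk]] := val_inv (oner_neq0 F); rewrite invr1 vk => -[kk].
by congr (_%:E)%E; lia.
Qed.

Let val_surj (k : int) : exists2 a, a != 0 & v a = k%:E%E.
Proof.
have [pi pi1] := lf_uniformizer F_local.
have pi0 : pi != 0 by apply/eqP => /(lf_val0 F_local); rewrite pi1.
have pos (m : nat) : v (pi ^+ m) = m%:Z%:E%E.
  elim: m => [|m IHm]; first by rewrite expr0 val1.
  by rewrite exprS (lf_valM F_local) IHm pi1 -EFinD; congr (_%:E)%E; lia.
have piX m : pi ^+ m != 0 by rewrite expf_neq0.
case: k => m; first by exists (pi ^+ m).
exists (pi ^+ m.+1)^-1; first by rewrite invr_eq0.
have [k [pk ->]] := val_inv (piX m.+1).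
by move: pk; rewrite pos => -[<-].
Qed.

Let vge_sum (I : Type) (t : seq I) k (x : I -> F) :
  (forall i, vge k (x i)) -> vge k (\sum_(i <- t) x i).
Proof.
move=> x_k; elim/big_ind: _ => [|y z|//]; [exact: vge0|exact: vgeD].
Qed.

Let vgeN k x : vge k x -> vge k (- x).
Proof.
rewrite -mulN1r -[k]add0r => kx; apply: vgeM; last by rewrite add0r in kx.
have n1 : -1 != 0 :> F by rewrite oppr_eq0 oner_neq0.
have [l [vl]] := val_inv n1; rewrite invrN1 vl => -[ll].
by rewrite lee_fin; lia.
Qed.

Let vge_integral (p : {poly F}) a : p \is monic -> (forall i, vge 0 p`_i) ->
  root p a -> vge 0 a.
Proof.
move=> p_mon p_int; rewrite rootE horner_coef.
have p_gt0 : (0 < size p)%N by rewrite size_poly_gt0 monic_neq0.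
have [->|a0] := eqVneq a 0; first by rewrite vge0.
have [k [ak ak']] := val_inv a0.
have aX (m : nat) : v (a ^+ m) = (m%:Z * k)%:E%E.
  elim: m => [|m IHm]; first by rewrite expr0 val1 mul0r.
  by rewrite exprS (lf_valM F_local) IHm ak -EFinD; congr (_%:E)%E; lia.
move: p_mon; rewrite monicE lead_coefE; case: (size p) p_gt0 => // d _ /= /eqP pd.
rewrite big_ord_recr /= pd mul1r addr_eq0 => /eqP sumE.
rewrite ak lee_fin leNgt; apply/negP => k_lt0.
(* Since k < 0, every term of degree below d has value at least (d - 1) k, which exceeds the value d
   k of [a ^+ d]. *)
have : vge ((d%:Z - 1) * k) (- a ^+ d).
  rewrite -sumE; apply: vge_sum => i.
  rewrite -[(d%:Z - 1) * k]add0r; apply: vgeM => //.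
  by rewrite aX lee_fin; have := ltn_ord i; nia.
by move/vgeN; rewrite opprK aX lee_fin; nia.
Qed.

Let scal_inj a : a *: \1%VF = 0 :> A -> a = 0.
Proof. by move/eqP; rewrite scaler_eq0 => /orP[/eqP//|/eqP]. Qed.

Let epow_scal a i : epow (a *: \1%VF : A) i = a ^+ i *: \1%VF.
Proof.
elim: i => [|i IHi]; first by rewrite expr0 scale1r.
rewrite /epow /= -/(epow _ i) IHi -comp_lfunZl -comp_lfunZr comp_lfun1l.
by rewrite scalerA exprS.
Qed.

Let epow_horner (p : {poly F}) a :
  \sum_(i < size p) p`_i *: epow (a *: \1%VF : A) i = p.[a] *: \1%VF.
Proof.
rewrite horner_coef scaler_suml.
by apply: eq_bigr => i _; rewrite epow_scal scalerA.
Qed.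

(** Powers of a scalar operator are scalar, so an integral equation for it is one for [a], and the
    valuation ring is integrally closed; conversely [a] is a root of X - a. *)
Let int_ring_scalars :
  int_ring v (@scalars F V) = [set a *: \1%VF | a in [set a | vge 0 a]].
Proof.
apply/seteqP; split=> [_ [[a _ <-]] [p [p_mon p_int pE]]|_ [a a0 <-]].
  exists a => //=; apply: vge_integral p_mon p_int _.
  by apply/eqP/scal_inj; rewrite -[RHS]pE epow_horner.
split; first by exists a.
exists ('X - a%:P); split; first exact: monicXsubC.
  move=> i; rewrite coefB coefX coefC; apply: vgeD; last first.
    by apply: vgeN; case: ifP => // _; apply: vge0.
  by case: eqP => _; [rewrite val1|apply: vge0].
by rewrite epow_horner hornerXsubC subrr scale0r.
Qed.

Let max_ideal_scalars :
  max_ideal v (@scalars F V) = [set a *: \1%VF | a in [set a | vge 1 a]].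
Proof.
rewrite /max_ideal int_ring_scalars; apply/seteqP; split=> [_ [[a a0 <-] nu]|_ [a a1 <-]].
  exists a => //=; have [a00|an0] := eqVneq a 0; first by rewrite a00 vge0.
  have [k [ak ak']] := val_inv an0; have k0 : 0 <= k by move: a0; rewrite /= ak lee_fin.
  rewrite /= ak lee_fin.
  have [|k_le0] := ltrP 0 k; first by lia.
  have k00 : k = 0 by lia.
  exfalso; apply: nu; split; first by exists a.
  exists (a^-1 *: \1%VF); first by exists a^-1; rewrite //= ak' k00.
  by rewrite -!comp_lfunZl -!comp_lfunZr comp_lfun1l !scalerA divff// mulVf// scale1r.
split; first by exists a => //=; apply: le_trans a1.
move=> [_ [_ [b /= b0 <-] [/eqP]]].
rewrite -comp_lfunZl -comp_lfunZr comp_lfun1l scalerA -subr_eq0.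
rewrite -{2}[\1%VF]scale1r -scalerBl => /eqP/scal_inj/eqP; rewrite subr_eq0 => /eqP ab.
by have := vgeM a1 b0; rewrite ab val1 lee_fin.
Qed.

Lemma scalars_field : is_field (@scalars F V).
Proof.
split=> //.
- by exists 1; rewrite // scale1r.
- move=> _ _ [a _ <-] [b _ <-]; split; first by exists (a - b); rewrite // scalerBl.
  by exists (a * b); rewrite // -comp_lfunZl -comp_lfunZr comp_lfun1l scalerA.
- move=> _ _ [a _ <-] [b _ <-].
  by rewrite -!comp_lfunZl -!comp_lfunZr comp_lfun1l !scalerA mulrC.
- move=> _ [a _ <-] a0; exists (a^-1 *: \1%VF); first by exists a^-1.
  have an0 : a != 0 by apply: contra_notN a0 => /eqP->; rewrite scale0r.
  by rewrite -comp_lfunZl -comp_lfunZr comp_lfun1l scalerA divff// scale1r.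
Qed.

(** The form is a coordinate, nonzero at [u], of the projection onto a complement along [W]. *)
Lemma separating_form (W : {vspace V}) u : u \notin W -> exists f : V -> F,
  [/\ forall a x y, f (a *: x + y) = a * f x + f y,
      forall w, w \in W -> f w = 0 & f u != 0].
Proof.
move=> uW; pose p := daddv_pi (W^C)%VS W.
have CW : (W^C :&: W = 0)%VS by rewrite capvC capv_compl.
have WC : (W :&: W^C = 0)%VS by rewrite capv_compl.
have pE x : p x + daddv_pi W (W^C)%VS x = x.
  by apply: daddv_pi_add => //; rewrite addvC addv_complf memvf.
have pW w : w \in W -> p w = 0.
  move=> wW; have := pE w; rewrite (daddv_pi_id WC wW).
  by move/eqP; rewrite -subr_eq0 addrK => /eqP.
have [i pui] : exists i, coord (vbasis {:V}) i (p u) != 0.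
  apply: contrapT => nex; move/negP: uW; apply; rewrite -(pE u).
  rewrite [p u](coord_vbasis (memvf _)) big1 ?add0r ?memv_pi// => i _.
  have [->|ci] := eqVneq (coord (vbasis {:V}) i (p u)) 0; first by rewrite scale0r.
  by case: nex; exists i.
exists (fun x => coord (vbasis {:V}) i (p x)); split=> //.
- by move=> a x y; rewrite !linearP.
- by move=> w /pW->; rewrite linear0.
Qed.

(** * Lattice chains over F are filtrations *)

Section Chain.
Context (L : int -> set V) (L_chain : lattice_chain v (@scalars F V) L).

Let L_anti i j : i <= j -> L j `<=` L i.
Proof. by case: L_chain => _ /chain_antitone + _; apply. Qed.

Let L0 i : L i 0.
Proof. by case: L_chain => + _ _ => /(_ i)[[t ->] _]; apply: mulspan0. Qed.

Let LD i x y : L i x -> L i y -> L i (x + y).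
Proof. by case: L_chain => + _ _ => /(_ i)[[t ->] _]; apply: mulspanD. Qed.

Let LZ i a x : vge 0 a -> L i x -> L i (a *: x).
Proof.
move=> a0; case: L_chain => + _ _ => /(_ i)[[t ->] _].
set M := mulspan _ _ _; apply: (@mulspan_min _ _ _ _ _ _ [set x | M (a *: x)]) => /=.
- by rewrite scaler0; apply: mulspan0.
- by move=> z z' Mz Mz'; rewrite scalerDr; apply: mulspanD.
- rewrite int_ring_scalars => _ y [b /= b0 <-] ty.
  have -> : a *: (b *: \1%VF : A) y = ((a * b) *: \1%VF : A) y.
    by rewrite !scale_lfunE scalerA.
  apply: mulspan_mul => //; rewrite int_ring_scalars; exists (a * b) => //=.
  by rewrite -[0]addr0; apply: vgeM.
Qed.

Let LB i x y : L i x -> L i y -> L i (x - y).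
Proof.
move=> Lx Ly; apply: LD => //; rewrite -scaleN1r; apply: LZ => //.
by apply: vgeN; rewrite val1.
Qed.

(** A uniformiser [pi] maps [L i] onto [L (i + e)]; its powers are moved one at a time from the
    scalar to the vector. *)
Let LZ_shift : exists2 e : int, 0 < e & forall k a i u,
  vge k a -> L i u -> L (i + k * e) (a *: u).
Proof.
have [_ _ [e e_gt0 eP]] := L_chain; exists e%:Z => //.
have [pi pi1] := lf_uniformizer F_local.
have pi0 : pi != 0 by apply/eqP => /(lf_val0 F_local); rewrite pi1.
have piV : v pi^-1 = (-1)%:E%E.
  by have [k [vk ->]] := val_inv pi0; move: vk; rewrite pi1 => -[<-].
have up i u : L i u -> L (i + e%:Z) (pi *: u).
  move=> Lu; rewrite -eP.
  have -> : pi *: u = (pi *: \1%VF : A) u by rewrite scale_lfunE id_lfunE.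
  by apply: mulspan_mul => //; rewrite max_ideal_scalars; exists pi; rewrite //= pi1.
have down i u : L (i + e%:Z) u -> L i (pi^-1 *: u).
  rewrite -eP; apply: (@mulspan_min _ _ _ _ _ _ [set u | L i (pi^-1 *: u)]) => /=.
  - by rewrite scaler0.
  - by move=> z z' Lz Lz'; rewrite scalerDr; apply: LD.
  - rewrite max_ideal_scalars => _ y [b /= b1 <-] Ly.
    rewrite scale_lfunE id_lfunE scalerA; apply: LZ => //.
    by apply: (@vgeM (-1) 1); rewrite // piV.
have pos (m : nat) a i u : vge m%:Z a -> L i u -> L (i + m%:Z * e%:Z) (a *: u).
  elim: m a i u => [|m IHm] a i u am Lu; first by rewrite mul0r addr0; apply: LZ.
  have -> : a *: u = (a * pi^-1) *: (pi *: u) by rewrite scalerA mulfVK.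
  rewrite (_ : _ + _ = i + e%:Z + m%:Z * e%:Z); last by lia.
  apply: IHm; last exact: up.
  by rewrite (_ : m%:Z = m.+1%:Z + -1); [apply: vgeM; rewrite // piV|lia].
have neg (m : nat) a i u : vge (- m%:Z) a -> L (i + m%:Z * e%:Z) u -> L i (a *: u).
  elim: m a i u => [|m IHm] a i u am Lu.
    by apply: LZ => //; move: Lu; rewrite mul0r addr0.
  have -> : a *: u = (a * pi) *: (pi^-1 *: u) by rewrite scalerA mulfK.
  apply: IHm; last by apply: down; move: Lu; rewrite (_ : i + _ = i + m%:Z * e%:Z + e%:Z); [|lia].
  by rewrite (_ : - m%:Z = - m.+1%:Z + 1); [apply: vgeM; rewrite // pi1|lia].
move=> [m|m] a i u ak Lu; first exact: pos.
apply: (neg m.+1) => //.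
by rewrite NegzE mulNr addrNK.
Qed.

Let L_exh u : exists i, L i u.
Proof.
have [e e_gt0 LZe] := LZ_shift.
have [+ _ _] := L_chain => /(_ 0)[_ LT].
have : [set: V] u by []; rewrite -LT.
apply: (@mulspan_min _ _ _ _ _ _ [set u | exists i, L i u]) => /=; first by exists 0.
  move=> z z' [i Lz] [j Lz']; exists (Num.min i j).
  by apply: LD; [apply: L_anti Lz|apply: L_anti Lz']; lia.
move=> _ y [a _ <-] Ly; rewrite scale_lfunE id_lfunE.
have [->|a0] := eqVneq a 0; first by exists 0; rewrite scale0r.
have [k [ak _]] := val_inv a0; exists (0 + k * e).
by apply: LZe; rewrite // ak.
Qed.

Let L0_gen : exists t : seq V, forall S : set V, S 0 ->
  (forall x y, S x -> S y -> S (x + y)) ->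
  (forall a x, vge 0 a -> x \in t -> S (a *: x)) -> L 0 `<=` S.
Proof.
have [+ _ _] := L_chain => /(_ 0)[[t ->] _]; exists t => S S0 SD SZ.
apply: mulspan_min => // x y; rewrite int_ring_scalars => -[a a0 <-] ty.
by rewrite scale_lfunE id_lfunE; apply: SZ.
Qed.

(** A form that vanishes on [W] but not at [u] is bounded on the finitely generated [L 0], hence
    small on differences [u - w] deep in the chain, although its value there is always [f u]. *)
Let L_closed (W : {vspace V}) u :
  (forall i, exists2 w, w \in W & L i (u - w)) -> u \in W.
Proof.
move=> uW; apply/negPn/negP => /separating_form[f [f_lin fW fu]].
have f0 : f 0 = 0 by apply: fW; rewrite mem0v.
have fZ a x : f (a *: x) = a * f x by rewrite -[a *: x]addr0 f_lin f0 addr0.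
have fD x y : f (x + y) = f x + f y by rewrite -[x]scale1r f_lin mul1r scale1r.
have [t tP] := L0_gen.
have [N tN] : exists N : int, forall x, x \in t -> vge N (f x).
  elim: t {tP} => [|x t [N tN]]; first by exists 0.
  have [M xM] : exists M : int, vge M (f x).
    have [->|fx] := eqVneq (f x) 0; first by exists 0; apply: vge0.
    by have [M [xM _]] := val_inv fx; exists M; rewrite xM.
  exists (Num.min N M) => y; rewrite inE => /orP[/eqP->|/tN yN].
    by apply: le_trans xM; rewrite lee_fin; lia.
  by apply: le_trans yN; rewrite lee_fin; lia.
have fL0 x : L 0 x -> vge N (f x).
  apply: (tP [set x | vge N (f x)]) => /=.
  - by rewrite f0 vge0.
  - by move=> y z yN zN; rewrite fD vgeD.
  - by move=> a y a0 /tN yN; rewrite fZ -[N]add0r vgeM.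
have [e e_gt0 LZe] := LZ_shift.
have [k [fk _]] := val_inv fu.
(* After division by [p] the difference [u - w] still lies in [L 0], but its value under [f] has
   valuation [k - m < N]. *)
have [p p0 pm] := val_surj (`|k - N| + 1).
set m := `|k - N| + 1 in pm.
have [w wW Lw] := uW (m * e).
have [l [pl pV]] := val_inv p0; move: pl; rewrite pm => -[lm]; rewrite -{}lm in pV.
have : vge N (f (p^-1 *: (u - w))).
  apply: fL0; rewrite (_ : 0 = m * e + (- m) * e); last by lia.
  by apply: LZe; rewrite // pV.
rewrite fZ fD -scaleN1r fZ (fW w)// mulr0 addr0 (lf_valM F_local) pV fk.
by rewrite -EFinD lee_fin /m; lia.
Qed.

Let L_shifts : exists2 e : int, 0 < e &
  forall a k, a != 0 -> v a = k%:E%E -> shifts L (a *: \1%VF) (k * e).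
Proof.
have [e e_gt0 LZe] := LZ_shift; exists e => // a k a0 ak i u.
rewrite scale_lfunE id_lfunE; split=> Lu; last by apply: LZe; rewrite // ak.
have [l [al aV]] := val_inv a0; move: al; rewrite ak => -[kl]; rewrite -{}kl in aV.
rewrite -[u]scale1r -(mulVf a0) -scalerA.
rewrite (_ : i = i + k * e + (- k) * e); last by lia.
by apply: LZe; rewrite // aV.
Qed.

Lemma chain_field_scalars : chain_field L (@scalars F V).
Proof.
have [e e_gt0 Ls] := L_shifts.
split=> //; first exact: scalars_field.
exists e => //; split.
  have [pi pi0 pi1] := val_surj 1.
  by exists (pi *: \1%VF); [exists pi|rewrite -[e]mul1r; apply: Ls].
move=> _ [a _ <-] a0.
have an0 : a != 0 by apply: contra_notN a0 => /eqP->; rewrite scale0r.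
by have [k [ak _]] := val_inv an0; exists k; apply: Ls.
Qed.

Lemma lattice_chain_filtration : filtration L.
Proof.
split=> //; first by case: L_chain.
move=> y; have [t tP] := L0_gen.
have [j tj] : exists j, forall x, x \in t -> L j (y x).
  elim: t {tP} => [|x t [j tj]]; first by exists 0.
  have [i Li] := L_exh (y x); exists (Num.min i j) => z.
  rewrite inE => /orP[/eqP->|/tj Lj]; first by apply: L_anti Li; lia.
  by apply: L_anti Lj; lia.
have yL0 x : L 0 x -> L j (y x).
  apply: (tP [set x | L j (y x)]) => /=.
  - by rewrite linear0.
  - by move=> x1 x2 L1 L2; rewrite linearD; apply: LD.
  - by move=> a x1 a0 /tj L1; rewrite linearZ; apply: LZ.
have [e e_gt0 Ls] := L_shifts.
(* [j] bounds [y] on [L 0]. Passing from [i] to the largest multiple [q * e] below it costs fewer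
   than [e] levels, and a scalar of degree [q * e] then reduces to [L 0]. *)
exists (absz j + absz e)%N => i u Lu.
have iE := divz_eq i e; have t_ge0 : 0 <= (i %% e)%Z by rewrite modz_ge0; lia.
have t_lt : (i %% e)%Z < e by rewrite ltz_pmod.
set q := (i %/ e)%Z in iE; set r := (i %% e)%Z in iE t_ge0 t_lt.
have [a a0 aq] := val_surj q; have a_s := Ls a q a0 aq.
have uE : u = a *: (a^-1 *: u) by rewrite scalerA divff// scale1r.
rewrite uE linearZ /= -[y _]id_lfunE -scale_lfunE.
apply: (L_anti (j := j + q * e)); first by lia.
rewrite a_s; apply: yL0; rewrite -a_s scale_lfunE id_lfunE -uE add0r.
by apply: L_anti Lu; lia.
Qed.

End Chain.
End LocalField.

(** * From sums of radical powers to products of unit groups *)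

Section Products.
Context (L : int -> set V) (L_fl : filtration L).
Hypothesis cf0 : chain_field L (@scalars F V).
Local Notation S := (@scalars F V).
Local Notation R := (chain_map L S 0).
Local Notation E b i := (adjoin S (b i)).
Local Notation onep X := [set \1%VF + x | x in X].

(** Combined with [rad_exp_chain_map], this is the equality of rad(B)^k with the intersection of P^k
    and End_K(V). *)
Lemma chain_mapE (K : set A) k : chain_map L K k = chain_map L S k `&` End_over K.
Proof.
by apply/seteqP; split=> x; rewrite /chain_map End_over_scalars; [case|case=> -[]].
Qed.

Lemma frakB_chain_map x : frakB S R x = chain_map L (adjoin S x) 0.
Proof. by rewrite [RHS]chain_mapE. Qed.

Lemma setcompA : associative (@setcomp F V).
Proof.
move=> X Y Z; apply/seteqP; split.
  move=> _ [x Xx [_ [y Yy [z Zz <-]] <-]].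
  by exists (x \o y)%VF; [exists x => //; exists y|exists z; rewrite // comp_lfunA].
move=> _ [_ [x Xx [y Yy <-]] [z Zz <-]].
by exists x => //; exists (y \o z)%VF; [exists y => //; exists z|rewrite comp_lfunA].
Qed.

Lemma setcomp_idl (X : set A) : setcomp [set \1%VF] X = X.
Proof.
apply/seteqP; split=> [_ [_ -> [x Xx <-]]|x Xx]; first by rewrite comp_lfun1l.
by exists \1%VF => //; exists x; rewrite // comp_lfun1l.
Qed.

(* [1 + y + x = (1 + y) (1 + (1 + y)^-1 x)] with [1 + y] a unit of the order. *)
Lemma onep_setadd (K X Y : set A) :
  Y `<=` chain_map L K 1 ->
  (forall c x, chain_map L K 0 c -> X x -> X (c \o x)%VF) ->
  onep (setadd Y X) = setcomp (onep Y) (onep X).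
Proof.
move=> Y1 X_l; apply/seteqP; split.
  move=> _ [_ [y Yy [x Xx <-]] <-].
  have [c [Hc yc _]] := chain_map_inv L_fl (Y1 _ Yy).
  exists (\1%VF + y); first by exists y.
  exists (\1%VF + (c \o x)%VF); first by exists (c \o x)%VF => //; apply: X_l.
  by rewrite comp_lfunDr comp_lfun1r comp_lfunA yc comp_lfun1l addrA.
move=> _ [_ [y Yy <-] [_ [x Xx <-] <-]].
exists (y + ((\1%VF + y) \o x)%VF).
  exists y => //; exists ((\1%VF + y) \o x)%VF => //; apply: X_l => //.
  apply: chain_mapD => //; first exact: chain_map_id.
  exact: (chain_map_le L_fl (l := 1)) (Y1 _ Yy).
by rewrite [RHS]comp_lfunDr comp_lfun1r addrA.
Qed.

Lemma setadd_modular (K X : set A) k : 0 <= k -> X `<=` chain_map L S k ->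
  setadd (chain_map L K 0) X `&` chain_map L S k = setadd (chain_map L K k) X.
Proof.
move=> k0 Xk; apply/seteqP; split.
  move=> _ [[y By [x Xx <-]] yx]; exists y; last by exists x.
  rewrite chain_mapE; split; last by case: By.
  by rewrite -(addrK x y); apply: chain_mapB => //; apply: Xk.
move=> _ [y Hy [x Xx <-]]; split.
  by exists y; [apply: chain_map_le Hy|exists x].
apply: chain_mapD => //; last exact: Xk.
by move: Hy; rewrite chain_mapE => -[].
Qed.

(** Left multiplication by a degree 0 map that centralises all the fields preserves each summand of
    H. Elements of [B_0] are such maps when the fields decrease, which gives the stability that
    [onep_setadd] asks for. *)
Lemma frakH_left n s (b : nat -> A) (r : nat -> int) x y : R x ->
  (forall i, (i <= s)%N -> End_over (E b i) x) ->
  frakH R n s b r y -> frakH R n s b r (x \o y)%VF.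
Proof.
elim: s b r y => [|s IHs] b r y Rx Ex /=; rewrite frakB_chain_map !rad_exp_chain_map//.
  move=> [z Hz [z' Hz' <-]]; rewrite comp_lfunDr.
  exists (x \o z)%VF; last by exists (x \o z')%VF => //; apply: chain_map_compl.
  by apply: chain_map_compl => //; rewrite chain_mapE; split=> //; apply: Ex.
move=> [z Hz [z' [Hz' Pz'] <-]]; rewrite comp_lfunDr.
exists (x \o z)%VF.
  by apply: chain_map_compl => //; rewrite chain_mapE; split=> //; apply: Ex.
exists (x \o z')%VF => //; split; last exact: chain_map_compl.
by apply: IHs => // i le_is; apply: (Ex i.+1).
Qed.

Lemma frakH_addl n s (b : nat -> A) (r : nat -> int) c x :
  chain_map L (E b 0%N) 0 c -> frakH R n s b r x -> frakH R n s b r (c + x).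
Proof.
case: s => [|s] Hc /=; rewrite frakB_chain_map => -[y Hy [z Hz <-]];
  by exists (c + y); [exact: chain_mapD|exists z; rewrite // addrA].
Qed.

(** Induction on [s], splitting off the order of the largest field. The initial value [r 0%N] is not
    fixed to 0 because the shifted sequence starts at [r 1%N]. *)
Lemma onep_frakH n s (b : nat -> A) (r : nat -> int) :
  (forall i, (i <= s)%N -> chain_field L (E b i)) ->
  (forall i, (i < s)%N -> E b i.+1 `<=` E b i) ->
  0 <= r 0%N -> (forall i, (i < s)%N -> r i <= r i.+1) -> r s <= n ->
  onep (frakH R n s b r `&` chain_map L S ((r 0%N %/ 2)%Z + 1)) =
  setcomp (onep (chain_map L (E b 0%N) ((r 0%N %/ 2)%Z + 1)))
    (setcomp
      (\big[@setcomp F V/[set \1%VF]]_(0 <= i < s)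
         onep (chain_map L (E b i.+1) ((r i.+1 %/ 2)%Z + 1)))
      (onep (chain_map L S ((n %/ 2)%Z + 1)))).
Proof.
elim: s b r => [|s IHs] b r cfE E_sub r0 r_le r_n.
  rewrite /= big_geq// setcomp_idl frakB_chain_map rad_exp_chain_map//.
  rewrite setadd_modular; [|lia|apply: chain_map_le => //; lia].
  apply: (@onep_setadd (E b 0%N)); first by apply: chain_map_le => //; lia.
  move=> c x; rewrite chain_mapE => -[Hc _]; exact: chain_map_compl.
have r01 := r_le _ (ltn0Sn s).
have b_sub i : (i <= s)%N -> E b i.+1 `<=` E b 0%N.
  elim: i => [|i IHi] lt_is; first exact: E_sub.
  by apply: subset_trans (IHi (ltnW lt_is)); apply: E_sub.
rewrite /= frakB_chain_map rad_exp_chain_map//.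
(* As [r 0%N <= r 1%N], the tail of H already has degree at least [r_0/2]+1, so the intersection
   only cuts down [B_0]. *)
rewrite setadd_modular; [|lia|]; last first.
  by apply: subset_trans (@subIsetr _ _ _) _; apply: chain_map_le => //; lia.
rewrite (@onep_setadd (E b 0%N)); last 2 first.
- by apply: chain_map_le => //; lia.
- move=> c x; rewrite chain_mapE => -[Rc Ec] [Hx Px]; split; last exact: chain_map_compl.
  apply: frakH_left => // i le_is k Ek; apply: Ec; exact: b_sub Ek.
congr (setcomp _ _); rewrite IHs//.
- by rewrite big_nat_recl// setcompA.
- by move=> i le_is; apply: (cfE i.+1).
- by move=> i lt_is; apply: (E_sub i.+1).
- lia.
- by move=> i lt_is; apply: (r_le i.+1).
Qed.

End Products.
End LatticeChains.

(** * The factorisation of H^1 *)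

Unset Implicit Arguments.

Theorem fact0p3 (F : fieldType) (v : F -> \bar int)
    (F_local : nonarch_local_field v) (V : vectType F)
    (R : set 'End(V)) (n : int) (beta : 'End(V))
    (s : nat) (b : nat -> 'End(V)) (r : nat -> int)
    (beta_max : maximal_simple_stratum v (@scalars F V) R n 0 beta)
    (beta_tame : tamely_ramified v (adjoin (@scalars F V) beta))
    (b_def : defining_sequence v R n 0 beta s b r)
    (b0 : b 0%N = beta)
    (b_sub : forall i, (i < s)%N ->
       adjoin (@scalars F V) (b i.+1) `<` adjoin (@scalars F V) (b i))
    (b_simple : forall i, (i < s)%N ->
       simple_stratum v (adjoin (@scalars F V) (b i.+1))
         (frakB (@scalars F V) R (b i.+1))
         (r i.+1) (r i.+1 - 1) (b i - b i.+1))
    (bs_notin : ~ scalars (b s)) :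
  let c := diff_seq s b in
  let E i := adjoin (@scalars F V) (b i) in
  let B i := frakB (@scalars F V) R (b i) in
  Hgroup R n s b r 1 =
  setcomp (U (E 0%N) (B 0%N) 1)
    (setcomp
      (\big[@setcomp F V/[set \1%VF]]_(0 <= i < s)
          U (E i.+1) (B i.+1) (half_level R (c i)))
      (U (@scalars F V) R (half_level R (c s)))).
Proof.
move=> c E B.
have pure i : (i <= s)%N -> pure_stratum v (@scalars F V) R n (r i) (b i).
  by move=> le_is; case: (ds_simple b_def le_is).
have [[L L_chain RE] _ _ _] : stratum v (@scalars F V) R n (r 0%N) (b 0%N).
  by case: (pure _ (leq0n s)).
have id_neq0 : \1%VF <> 0 :> 'End(V) by case: (pure _ (leq0n s)) => _ [].
have L_fl := lattice_chain_filtration F_local id_neq0 L_chain.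
have cf0 := chain_field_scalars F_local id_neq0 L_chain.
have {}RE : R = chain_map L (@scalars F V) 0.
  rewrite RE; apply/seteqP; split=> x [Sx xL]; split=> // i.
    by move=> u Lu; rewrite addr0; apply: xL; exists u.
  by move=> _ [u Lu <-]; rewrite -[i]addr0; apply: xL.
have scal_sub x : @scalars F V `<=` adjoin (@scalars F V) x.
  move=> a Sa; rewrite -[a]comp_lfun1r.
  by apply: (@mulspan_mul _ _ _ (fun x y : 'End(V) => (x \o y)%VF)) => //; exists 0%N.
have cfE i : (i <= s)%N -> chain_field L (E i).
  move=> /pure[_ E_field E_norm _]; apply: chain_field_of_normaliser => //.
  - exact: scal_sub.
  - by move: E_norm; rewrite RE.
have BE i : B i = chain_map L (E i) 0 by rewrite /B RE frakB_chain_map.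
have UE i k : (i <= s)%N -> 0 < k ->
    U (E i) (B i) k = [set \1%VF + x | x in chain_map L (E i) k].
  by move=> le_is k0; rewrite /U k0 BE rad_exp_chain_map//; apply: cfE.
have U0E k : 0 < k ->
    U (@scalars F V) R k = [set \1%VF + x | x in chain_map L (@scalars F V) k].
  by move=> k0; rewrite /U k0 RE rad_exp_chain_map.
have r0 : r 0%N = 0 := ds_r0 b_def.
have r_le i : (i < s)%N -> r i <= r i.+1.
  by move=> lt_is; have := ds_r_incr b_def lt_is; lia.
have r_ge0 i : (i <= s)%N -> 0 <= r i.
  elim: i => [|i IHi] le_is; first by rewrite r0.
  by have := r_le _ le_is; have := IHi (ltnW le_is); lia.
have r_n : r s < n := ds_r_last b_def.
have n_ge0 : 0 <= n by have := r_ge0 _ (leqnn s); lia.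
have lev_i i : (i < s)%N -> half_level R (c i) = (r i.+1 %/ 2)%Z + 1.
  move=> lt_is; rewrite /half_level /c /diff_seq lt_is.
  have [[[_ _ cE _] _ _ nuE] _] := b_simple _ lt_is.
  (* [c_i] is linear over E_(i+1), so its degree in the filtration gives its valuation for both
     orders; the one for [B i.+1] is -r_(i+1) by purity of the given stratum. *)
  have -> : nu (@scalars F V) R (b i - b i.+1) = nu (E i.+1) (B i.+1) (b i - b i.+1).
    rewrite /nu; congr zsup; apply/seteqP; split=> k /=; rewrite BE RE;
      rewrite (rad_exp_chain_map L_fl cf0) (rad_exp_chain_map L_fl (cfE _ lt_is));
      rewrite (chain_mapE _ (E i.+1)); last by case.
    by move=> Hc; split=> //; move: cE.
  by rewrite nuE /= opprK.
have lev_s : half_level R (c s) = (n %/ 2)%Z + 1.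
  rewrite /half_level /c /diff_seq ltnn.
  by have [_ _ _ ->] := pure _ (leqnn s); rewrite /= opprK.
rewrite lev_s U0E; last by lia.
rewrite (UE 0%N)//; under eq_big_nat => i /andP[_ lt_is].
  rewrite lev_i// UE//; first over.
  by have := r_ge0 _ lt_is; lia.
(* Since r_0 = 0, the first factor has level 1 and the degree condition on H is membership in P. *)
have lev0 : (r 0%N %/ 2)%Z + 1 = 1 by rewrite r0.
have := onep_frakH L_fl cf0 (n := n) cfE _ _ r_le _; rewrite lev0 => <-; last first.
- lia.
- by rewrite r0.
- by move=> i /b_sub[].
rewrite /Hgroup U0E// RE.
have id_map : chain_map L (E 0%N) 0 \1%VF := chain_map_id _ _.
(* As 1 lies in [B_0], H is stable under adding 1 or -1, so 1 + x lies in H exactly when [x]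
   does. *)
apply/seteqP; split=> [z [Hz [x Px zE]]|_ [x [Hx Px] <-]]; last first.
  by split; [exact: frakH_addl|exists x].
exists x => //; split=> //; rewrite -[x](addKr \1%VF) zE.
apply: frakH_addl => //; rewrite -sub0r.
by apply: chain_mapB => //; exact: chain_map0.
Qed.
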